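(* Let $k\in\mathbb N$ and let $I$ be an ideal of $\mathcal R^k_{[1]}(\mathbb R^2)$. Then there exists $f\in I$ such that for every $g\in I$ there exist an integer $N\in\mathbb N$ and $h\in\mathcal R^k_{[1]}(\mathbb R^2)$ with $g^N=fh$. In particular, there exists $f\in I$ with $\sqrt{I}=\sqrt{(f)}$.
   Context: For $k\in\mathbb N\cup\{\infty\}$, $\mathcal R^k(\mathbb R^2)$ denotes the ring of functions $f:\mathbb R^2\to\mathbb R$ of class $C^k$ that coincide with $p/q$ ($p,q$ polynomials, $q$ nonvanishing there) on some nonempty Zariski open set. For $l\in\mathbb N$: consider compositions $\pi:M\to\mathbb R^2$ of successive blowings-up $M_i\to M_{i-1}$ ($M_0=\mathbb R^2$), each centred at points. An infinitely near point of order $j$ is a sequence $a_0\in M_0,\dots,a_j\in M_j$ where $M_i$ is the blowing-up of $M_{i-1}$ at $a_{i-1}$ and $a_i$ maps to $a_{i-1}$; the number of stages of $\pi$ is the maximal order of infinitely near points in $M$. $\mathcal R^k_{[l]}(\mathbb R^2)$ is the set of $f\in\mathcal R^k(\mathbb R^2)$ for which there is such a $\pi$ with at most $l$ stages such that $f\circ\pi$ is regular on $M$. *)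

(* Defs.v *)
From Stdlib Require Import Reals List.
Import ListNotations.
Open Scope R_scope.

Definition fn2 := R -> R -> R.

Definition poly2 := list (R * nat * nat).

Definition peval (p : poly2) (x y : R) : R :=
  fold_right (fun m acc => let '(c, i, j) := m in c * x ^ i * y ^ j + acc) 0 p.

Definition cont2 (f : fn2) : Prop :=
  forall x y eps, 0 < eps -> exists delta, 0 < delta /\
    forall x' y', Rabs (x' - x) < delta -> Rabs (y' - y) < delta ->
      Rabs (f x' y' - f x y) < eps.

Fixpoint Ck (k : nat) (f : fn2) : Prop :=
  match k with
  | O => cont2 f
  | S k' => cont2 f /\ exists fx fy : fn2,
      (forall x y, derivable_pt_lim (fun t => f t y) x (fx x y)) /\
      (forall x y, derivable_pt_lim (fun t => f x t) y (fy x y)) /\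
      Ck k' fx /\ Ck k' fy
  end.

(* f coincides with p/q (q nonvanishing there) on a nonempty Zariski open set
   {r <> 0}. *)
Definition rational2 (f : fn2) : Prop :=
  exists p q r : poly2, (exists x0 y0, peval r x0 y0 <> 0) /\
    forall x y, peval r x y <> 0 ->
      peval q x y <> 0 /\ f x y = peval p x y / peval q x y.

Definition Rk (k : nat) (f : fn2) : Prop := Ck k f /\ rational2 f.

(* f is regular at (x,y): f = p/q, q(x,y) <> 0, on a Zariski neighbourhood
   {r <> 0} of (x,y). *)
Definition regular_at (f : fn2) (x y : R) : Prop :=
  exists p q r : poly2, peval q x y <> 0 /\ peval r x y <> 0 /\
    forall x' y', peval r x' y' <> 0 ->
      peval q x' y' <> 0 /\ f x' y' = peval p x' y' / peval q x' y'.

(* f o pi is regular on M, where pi : M -> R^2 is the blowing-up of R^2 at the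
   finite set of points S (a one-stage composition of point blowings-up).
   Regularity is checked in charts: away from S in the original coordinates,
   and along the exceptional divisor over each a in S in the two standard
   affine charts (u,w) |-> (a1 + u, a2 + u w) and (u,w) |-> (a1 + u w, a2 + u),
   whose exceptional divisor is {u = 0}. *)
Definition regular_after_blowup (S : list (R * R)) (f : fn2) : Prop :=
  (forall x y, ~ In (x, y) S -> regular_at f x y) /\
  (forall a, In a S -> forall w,
     regular_at (fun u w' => f (fst a + u) (snd a + u * w')) 0 w /\
     regular_at (fun u w' => f (fst a + u * w') (snd a + u)) 0 w).

Definition Rk1 (k : nat) (f : fn2) : Prop :=
  Rk k f /\ exists S : list (R * R), regular_after_blowup S f.

Definition is_ideal_Rk1 (k : nat) (I : fn2 -> Prop) : Prop :=
  (forall g, I g -> Rk1 k g) /\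
  I (fun _ _ => 0) /\
  (forall g h, I g -> I h -> I (fun x y => g x y + h x y)) /\
  (forall a g, Rk1 k a -> I g -> I (fun x y => a x y * g x y)).

(* Main.v *)
Require Import Defs.
From Stdlib Require Import Reals List.
From Stdlib Require Import Wf_nat Lra Lia Classical ClassicalEpsilon FunctionalExtensionality.
From Coquelicot Require Import Coquelicot.
Import ListNotations.
Open Scope R_scope.

(** The polynomials in I form an ideal J. Up to polynomials without real zeros, J has a greatest
    common divisor d, and J contains d a(x) and d b(y) with a, b nonzero. Balancing the multiplicities
    of the real roots, J contains d e, where e vanishes only on a finite grid Z and has the same order
    2m along the whole exceptional divisor over each point of Z. A denominator q of g in I gives q g in
    J, so that q g = d p'; since g is regular after one blowing-up, near each point of the exceptional
    divisor q can be chosen to be a power u^n times a unit.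

    The points where d e vanishes but some element of I does not form a finite set W: apart from the
    points of Z they are isolated zeros of d. Choose G in I without zeros on W, a polynomial T vanishing
    exactly at the points of Z and the poles of G outside W, and put f = (d e)^2 + T^K G^2. For large K,
    f is outside W equal to d^2 times a function of exact order along each exceptional divisor. Hence
    for g in I the quotient g^N / f becomes regular after blowing up finitely many points, and where f
    and g vanish it has order at least k + 1 along the exceptional divisor when N is large, which makes
    it of class C^k: a partial derivative lowers that order by one. *)

(** * Polynomial functions of two variables *)

(** Everything rests on one cancellation: if [q g = d p] and [q1^2 f = d^2 B], then
    [g^2 / f = (q1 p)^2 / (q^2 B)]. The common divisor disappears, and the other [N - 2] factors [g]
    only raise the order along the exceptional divisors. Since a divisor may not be blown up again,
    [q], [q1] and [B] must be a power of [u] times a unit at each of its points. This is why [e] is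
    a sum of two squares of equal multiplicity, whose strict transform avoids the divisor, and why
    [T^K] must have larger order than the term it is added to. Common divisors come from
    pseudo-division in [y]. It leaves denominators in [x], of which only the real roots need to be
    cancelled, because a polynomial without real zeros is invertible among regular functions. The
    set [W] is a genuine obstacle: for [k = 0], every polynomial in the ideal generated by
    [1 + x^3 / (x^2 + y^2)] (with value 1 at the origin) is divisible by [x^2 + y^2 + x^3], hence
    vanishes at the origin, where the generator does not. *)

Definition polyfun (F : fn2) : Prop := exists p : poly2, forall x y, F x y = peval p x y.

Lemma polyfun_ext (F G : fn2) : (forall x y, F x y = G x y) -> polyfun F -> polyfun G.
Proof. intros E [p Hp]; exists p; intros x y; rewrite <- E; apply Hp. Qed.

Lemma peval_app p q x y : peval (p ++ q) x y = peval p x y + peval q x y.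
Proof. induction p as [|[[c i] j] p IH]; simpl; [lra|]. unfold peval in *; rewrite IH; lra. Qed.

Lemma polyfun_plus (F G : fn2) : polyfun F -> polyfun G -> polyfun (fun x y => F x y + G x y).
Proof. intros [p Hp] [q Hq]; exists (p ++ q); intros; now rewrite peval_app, Hp, Hq. Qed.

Lemma polyfun_monomial (c : R) i j : polyfun (fun x y => c * x ^ i * y ^ j).
Proof. exists [(c, i, j)]; intros; simpl; lra. Qed.

Lemma polyfun_const (c : R) : polyfun (fun _ _ => c).
Proof. apply (polyfun_ext (fun x y => c * x ^ 0 * y ^ 0)); [intros; simpl; ring | apply polyfun_monomial]. Qed.

Lemma polyfun_fst : polyfun (fun x _ => x).
Proof. apply (polyfun_ext (fun x y => 1 * x ^ 1 * y ^ 0)); [intros; simpl; ring | apply polyfun_monomial]. Qed.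

Lemma polyfun_snd : polyfun (fun _ y => y).
Proof. apply (polyfun_ext (fun x y => 1 * x ^ 0 * y ^ 1)); [intros; simpl; ring | apply polyfun_monomial]. Qed.

(** Induction on the list of monomials, transported to functions; the first hypothesis absorbs the
    change of representation. *)
Lemma polyfun_ind (P : fn2 -> Prop) :
  (forall F G : fn2, (forall x y, F x y = G x y) -> P F -> P G) ->
  P (fun _ _ => 0) ->
  (forall c i j F, polyfun F -> P F -> P (fun x y => c * x ^ i * y ^ j + F x y)) ->
  forall F, polyfun F -> P F.
Proof.
  intros Hext H0 HS F [p Hp]; apply (Hext (peval p)); [now intros; rewrite Hp|].
  clear F Hp; induction p as [|[[c i] j] p IH].
  - now apply (Hext (fun _ _ => 0)).
  - apply (Hext (fun x y => c * x ^ i * y ^ j + peval p x y)); [reflexivity|].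
    apply HS; [now exists p | exact IH].
Qed.

Lemma polyfun_mult (F G : fn2) : polyfun F -> polyfun G -> polyfun (fun x y => F x y * G x y).
Proof.
  intros HF HG; revert F HF; apply polyfun_ind.
  - intros F F' E; apply polyfun_ext; intros; now rewrite E.
  - apply (polyfun_ext (fun _ _ => 0)); [intros; ring | apply polyfun_const].
  - intros c i j F _ IH.
    apply (polyfun_ext (fun x y => c * x ^ i * y ^ j * G x y + F x y * G x y)); [intros; ring|].
    apply polyfun_plus; [|exact IH]. clear F IH; revert G HG; apply polyfun_ind.
    + intros F F' E; apply polyfun_ext; intros; now rewrite E.
    + apply (polyfun_ext (fun _ _ => 0)); [intros; ring | apply polyfun_const].
    + intros c' i' j' F _ IH.
      apply (polyfun_ext (fun x y => (c * c') * x ^ (i + i') * y ^ (j + j') + c * x ^ i * y ^ j * F x y)).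
      { intros; rewrite !pow_add; ring. }
      apply polyfun_plus; [apply polyfun_monomial | exact IH].
Qed.

Lemma polyfun_opp (F : fn2) : polyfun F -> polyfun (fun x y => - F x y).
Proof.
  intros H; apply (polyfun_ext (fun x y => (-1) * F x y)); [intros; ring|].
  apply (polyfun_mult (fun _ _ => -1)); [apply polyfun_const | exact H].
Qed.

Lemma polyfun_minus (F G : fn2) : polyfun F -> polyfun G -> polyfun (fun x y => F x y - G x y).
Proof. intros HF HG; apply (polyfun_plus F (fun x y => - G x y) HF); now apply polyfun_opp. Qed.

Lemma polyfun_pow (F : fn2) n : polyfun F -> polyfun (fun x y => F x y ^ n).
Proof.
  intros H; induction n as [|n IH]; [apply (polyfun_const 1)|].
  exact (polyfun_mult F (fun x y => F x y ^ n) H IH).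
Qed.

Lemma polyfun_comp (F A B : fn2) :
  polyfun F -> polyfun A -> polyfun B -> polyfun (fun x y => F (A x y) (B x y)).
Proof.
  intros HF HA HB; revert F HF; apply polyfun_ind.
  - intros F F' E; apply polyfun_ext; intros; now rewrite E.
  - apply polyfun_const.
  - intros c i j F _ IH; apply polyfun_plus; [|exact IH].
    apply polyfun_mult; [apply polyfun_mult|]; [apply polyfun_const| |]; now apply polyfun_pow.
Qed.

Lemma polyfun_if (s : bool) (F G : fn2) :
  polyfun F -> polyfun G -> polyfun (fun x y => if s then F x y else G x y).
Proof. now destruct s. Qed.

Ltac polyfun_tac :=
  repeat first
    [ assumption
    | apply polyfun_fst | apply polyfun_snd | apply polyfun_const
    | apply polyfun_plus | apply polyfun_minus | apply polyfun_mult
    | apply polyfun_opp | apply polyfun_pow | apply polyfun_if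
    | match goal with
      | H : polyfun ?F |- polyfun (fun x y => ?F (@?A x y) (@?B x y)) => apply (polyfun_comp F A B H)
      | H : polyfun (fun x _ => ?c x) |- polyfun (fun x y => ?c (@?A x y)) =>
          apply (polyfun_comp (fun x _ => c x) A (fun _ _ => 0) H)
      | H : polyfun (fun _ y => ?c y) |- polyfun (fun x y => ?c (@?A x y)) =>
          apply (polyfun_comp (fun _ y => c y) (fun _ _ => 0) A H)
      end ].

(** * Univariate polynomials and their real roots *)

(* The number of coefficients is at most [D], so [upoly 0 c] says [c = 0]. *)
Fixpoint upoly (D : nat) (c : R -> R) : Prop :=
  match D with
  | O => forall x, c x = 0
  | S D' => exists a g, upoly D' g /\ forall x, c x = a + x * g x
  end.

Lemma upoly_ext D c c' : (forall x, c x = c' x) -> upoly D c -> upoly D c'.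
Proof.
  destruct D; simpl; intros E H; [intros; now rewrite <- E|].
  destruct H as (a & g & Hg & H); exists a, g; split; [exact Hg|]; intros; now rewrite <- E.
Qed.

Lemma upoly_S D : forall c, upoly D c -> upoly (S D) c.
Proof.
  induction D as [|D IH]; simpl; intros c H.
  - exists 0, (fun _ => 0); split; [reflexivity|]; intros; rewrite H; ring.
  - destruct H as (a & g & Hg & H); exists a, g; split; [apply IH, Hg | exact H].
Qed.

Lemma upoly_le D D' c : (D <= D')%nat -> upoly D c -> upoly D' c.
Proof. induction 1; [easy|]. intros; apply upoly_S; auto. Qed.

Lemma upoly_plus D : forall c c', upoly D c -> upoly D c' -> upoly D (fun x => c x + c' x).
Proof.
  induction D as [|D IH]; simpl; intros c c' H H'; [intros; rewrite H, H'; ring|].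
  destruct H as (a & g & Hg & H), H' as (a' & g' & Hg' & H').
  exists (a + a'), (fun x => g x + g' x); split; [now apply IH|]; intros; rewrite H, H'; ring.
Qed.

Lemma upoly_scal D r : forall c, upoly D c -> upoly D (fun x => r * c x).
Proof.
  induction D as [|D IH]; simpl; intros c H; [intros; rewrite H; ring|].
  destruct H as (a & g & Hg & H).
  exists (r * a), (fun x => r * g x); split; [now apply IH|]; intros; rewrite H; ring.
Qed.

Lemma upoly_pow i : upoly (S i) (fun x => x ^ i).
Proof.
  induction i as [|i IH].
  - exists 1, (fun _ => 0); split; [now simpl|]; intros; simpl; ring.
  - exists 0, (fun x => x ^ i); split; [exact IH|]; intros; simpl; ring.
Qed.

Lemma polyfun_upoly F y : polyfun F -> exists D, upoly D (fun x => F x y).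
Proof.
  revert F; apply polyfun_ind.
  - intros F G E [D H]; exists D; revert H; apply upoly_ext; intros; apply E.
  - exists O; now simpl.
  - intros c i j F _ [D H]; exists (S i + D)%nat; apply upoly_plus.
    + apply (upoly_ext _ (fun x => (c * y ^ j) * x ^ i)); [intros; ring|].
      apply upoly_scal; apply (upoly_le (S i)); [lia | apply upoly_pow].
    + revert H; apply upoly_le; lia.
Qed.

Lemma polyfun_swap F : polyfun F -> polyfun (fun x y => F y x).
Proof. intros; polyfun_tac. Qed.

Lemma upoly_polyfun D : forall c, upoly D c -> polyfun (fun x _ => c x).
Proof.
  induction D as [|D IH]; simpl; intros c H.
  - apply (polyfun_ext (fun _ _ => 0)); [intros; now rewrite H | apply polyfun_const].
  - destruct H as (a & g & Hg & H). apply IH in Hg.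
    apply (polyfun_ext (fun x _ => a + x * g x)); [intros; now rewrite H|]. polyfun_tac.
Qed.

(** Division by [x - r] lowers the coefficient count, which is the measure on which the
    factorisations below terminate. *)
Lemma upoly_taylor D : forall c, upoly (S D) c -> forall r,
  exists g, upoly D g /\ forall x, c x = c r + (x - r) * g x.
Proof.
  induction D as [|D IH]; intros c (a & c1 & H1 & H) r.
  - exists (fun _ => 0); split; [now simpl|]; intros; simpl in H1; rewrite !H, !H1; ring.
  - destruct (IH c1 H1 r) as (g & Hg & E).
    exists (fun x => c1 r + x * g x); split; [now exists (c1 r), g|].
    intros x; rewrite !H, (E x); ring.
Qed.

Definition rootprod (l : list R) (x : R) : R := fold_right (fun r acc => (x - r) * acc) 1 l.

Lemma rootprod_app l l' x : rootprod (l ++ l') x = rootprod l x * rootprod l' x.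
Proof. induction l as [|r l IH]; simpl; [ring|]. rewrite IH; ring. Qed.

Lemma rootprod_0 l x : rootprod l x = 0 <-> In x l.
Proof.
  induction l as [|r l IH]; simpl; [split; [lra|easy]|]. split.
  - intros H; destruct (Rmult_integral _ _ H) as [H1|H1]; [left; lra | right; now apply IH].
  - intros [->|H]; [ring | apply IH in H; rewrite H; ring].
Qed.

Lemma polyfun_rootprod l : polyfun (fun x _ => rootprod l x).
Proof.
  induction l as [|r l IH]; [apply (polyfun_const 1)|].
  apply (polyfun_mult (fun x _ => x - r) (fun x _ => rootprod l x)); [polyfun_tac | exact IH].
Qed.

(** Roots are split off until none is left; the zero-free cofactor [c0] plays the part of a unit
    from here on. *)
Lemma upoly_factor D : forall c, upoly D c -> (exists x, c x <> 0) ->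
  exists l c0, polyfun (fun x _ => c0 x) /\ (forall x, c0 x <> 0) /\
    forall x, c x = rootprod l x * c0 x.
Proof.
  induction D as [|D IH]; intros c H [x0 Hx0]; [now destruct Hx0|].
  destruct (classic (exists r, c r = 0)) as [[r Hr]|N].
  - destruct (upoly_taylor D c H r) as (g & Hg & E).
    destruct (IH g Hg) as (l & c0 & Hc0 & Hn & E').
    { exists x0; intros Z; apply Hx0; rewrite E, Hr, Z; ring. }
    exists (r :: l), c0; split; [exact Hc0|]; split; [exact Hn|].
    intros x; simpl; rewrite E, Hr, E'; ring.
  - exists [], c; split; [now apply upoly_polyfun in H|]. split; [|intros; simpl; ring].
    intros x Hx; apply N; now exists x.
Qed.

Lemma polyfun_factor c : polyfun (fun x _ => c x) -> (exists x, c x <> 0) ->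
  exists l c0, polyfun (fun x _ => c0 x) /\ (forall x, c0 x <> 0) /\
    forall x, c x = rootprod l x * c0 x.
Proof. intros H; destruct (polyfun_upoly _ 0 H) as [D HD]; exact (upoly_factor D c HD). Qed.

Lemma polyfun_fix_snd F y : polyfun F -> polyfun (fun x _ => F x y).
Proof. intros; polyfun_tac. Qed.

Lemma polyfun_fix_fst F x : polyfun F -> polyfun (fun y _ => F x y).
Proof. intros; polyfun_tac. Qed.

Lemma polyfun_finite_roots c : polyfun (fun x _ => c x) -> (exists x, c x <> 0) ->
  exists l, forall x, c x = 0 -> In x l.
Proof.
  intros H Hn; destruct (polyfun_factor c H Hn) as (l & c0 & _ & H0 & E).
  exists l; intros x Hx; apply rootprod_0. rewrite E in Hx.
  destruct (Rmult_integral _ _ Hx) as [?|Z]; [assumption | now destruct (H0 x)].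
Qed.

Lemma interval_avoids_list (l : list R) : forall a b, a < b -> exists x, a < x < b /\ ~ In x l.
Proof.
  induction l as [|r l IH]; intros a b H; [exists ((a + b) / 2); split; [lra|easy]|].
  destruct (Rle_dec r ((a + b) / 2)) as [L|L].
  - destruct (IH ((a + b) / 2) b) as (x & Hx & Hl); [lra|].
    exists x; split; [lra|]; intros [->|?]; [lra | now apply Hl].
  - destruct (IH a ((a + b) / 2)) as (x & Hx & Hl); [lra|].
    exists x; split; [lra|]; intros [->|?]; [lra | now apply Hl].
Qed.

Lemma polyfun_zero_interval c a b l : polyfun (fun x _ => c x) -> a < b ->
  (forall x, a < x < b -> ~ In x l -> c x = 0) -> forall x, c x = 0.
Proof.
  intros H Hab Hz x; apply NNPP; intros Hx.
  destruct (polyfun_finite_roots c H) as [l' Hl']; [now exists x|].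
  destruct (interval_avoids_list (l ++ l') a b Hab) as (t & Ht & Nt).
  apply Nt, in_or_app; right; apply Hl', Hz; [exact Ht|]. intros ?; apply Nt, in_or_app; now left.
Qed.

Lemma polyfun_zero_box F a b del : polyfun F -> 0 < del ->
  (forall x y, Rabs (x - a) < del -> Rabs (y - b) < del -> F x y = 0) ->
  forall x y, F x y = 0.
Proof.
  intros HF Hd Hz x y.
  assert (K : forall t, Rabs (t - a) < del -> F t y = 0).
  { intros t Ht. apply (polyfun_zero_interval (fun y => F t y) (b - del) (b + del) []); [now apply polyfun_fix_fst | lra |].
    intros v Hv _; apply Hz; [exact Ht | apply Rabs_def1; lra]. }
  apply (polyfun_zero_interval (fun x => F x y) (a - del) (a + del) []); [now apply polyfun_fix_snd | lra |].
  intros t Ht _; apply K, Rabs_def1; lra.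
Qed.

Lemma polyfun_integral_1 c c' : polyfun (fun x _ => c x) -> polyfun (fun x _ => c' x) ->
  (forall x, c x * c' x = 0) -> (exists x, c x <> 0) -> forall x, c' x = 0.
Proof.
  intros H H' Z Hn. destruct (polyfun_finite_roots c H Hn) as [l Hl].
  apply (polyfun_zero_interval c' 0 1 l H'); [lra|]. intros x _ Nx.
  destruct (Rmult_integral _ _ (Z x)) as [E|E]; [now apply Hl in E | exact E].
Qed.

(** The equality off the line [x = r] extends to that line because, for fixed [y], a nonzero
    polynomial in [x] has finitely many roots. *)
Lemma polyfun_cancel F G r : polyfun F -> polyfun G ->
  (forall x y, (x - r) * F x y = (x - r) * G x y) -> forall x y, F x y = G x y.
Proof.
  intros HF HG E x y; apply Rminus_diag_uniq.
  apply (polyfun_integral_1 (fun x => x - r) (fun x => F x y - G x y)).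
  - polyfun_tac.
  - polyfun_tac.
  - intros t; generalize (E t y); lra.
  - exists (r + 1); lra.
Qed.

Lemma polyfun_taylor F r : polyfun F ->
  exists F1, polyfun F1 /\ forall x y, F x y = F r y + (x - r) * F1 x y.
Proof.
  revert F; apply polyfun_ind.
  - intros F G E (F1 & H1 & H); exists F1; split; [exact H1|]; intros; now rewrite <- !E.
  - exists (fun _ _ => 0); split; [apply polyfun_const | intros; ring].
  - intros c i j F _ (F1 & H1 & H).
    destruct (upoly_taylor i (fun x => x ^ i) (upoly_pow i) r) as (g & Hg & E).
    apply upoly_polyfun in Hg.
    exists (fun x y => c * g x * y ^ j + F1 x y); split; [polyfun_tac|].
    intros x y; rewrite (H x y), (E x); ring.
Qed.

(** * Common divisors of polynomial ideals *)

Lemma fn2_eq (F G : fn2) : (forall x y, F x y = G x y) -> F = G.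
Proof.
  intros E; apply functional_extensionality; intros x; apply functional_extensionality; intros y; apply E.
Qed.

Lemma fn2_ext (P : fn2 -> Prop) (F G : fn2) : (forall x y, F x y = G x y) -> P F -> P G.
Proof. intros E; now rewrite (fn2_eq F G E). Qed.

(* [F] has degree less than [n] in [y], with the leading coefficient split off first. *)
Fixpoint ypoly (n : nat) (F : fn2) : Prop :=
  match n with
  | O => forall x y, F x y = 0
  | S n' => exists c G, polyfun (fun x _ => c x) /\ ypoly n' G /\
      forall x y, F x y = c x * y ^ n' + G x y
  end.

Lemma ypoly_ext n F G : (forall x y, F x y = G x y) -> ypoly n F -> ypoly n G.
Proof. apply fn2_ext. Qed.

Lemma ypoly_le n n' F : (n <= n')%nat -> ypoly n F -> ypoly n' F.
Proof.
  induction 1; [easy|]. intros H1; exists (fun _ => 0), F; split; [apply polyfun_const|].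
  split; [auto|]; intros; ring.
Qed.

Lemma ypoly_plus n : forall F G, ypoly n F -> ypoly n G -> ypoly n (fun x y => F x y + G x y).
Proof.
  induction n as [|n IH]; simpl; intros F G HF HG; [intros; rewrite HF, HG; ring|].
  destruct HF as (c & F1 & Hc & HF1 & EF), HG as (c' & G1 & Hc' & HG1 & EG).
  exists (fun x => c x + c' x), (fun x y => F1 x y + G1 x y).
  split; [polyfun_tac|]. split; [now apply IH|]. intros; rewrite EF, EG; ring.
Qed.

Lemma ypoly_scal n a : polyfun (fun x _ => a x) ->
  forall F, ypoly n F -> ypoly n (fun x y => a x * F x y).
Proof.
  intros Ha; induction n as [|n IH]; simpl; intros F HF; [intros; rewrite HF; ring|].
  destruct HF as (c & F1 & Hc & HF1 & EF).
  exists (fun x => a x * c x), (fun x y => a x * F1 x y).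
  split; [polyfun_tac|]. split; [now apply IH|]. intros; rewrite EF; ring.
Qed.

Lemma ypoly_shift n j : forall F, ypoly n F -> ypoly (n + j) (fun x y => y ^ j * F x y).
Proof.
  induction n as [|n IH]; simpl; intros F HF.
  - apply (ypoly_le 0); [lia|]. intros x y; rewrite HF; ring.
  - destruct HF as (c & F1 & Hc & HF1 & EF).
    exists c, (fun x y => y ^ j * F1 x y); split; [exact Hc|]. split; [now apply IH|].
    intros; rewrite EF, pow_add; ring.
Qed.

Lemma ypoly_polyfun n : forall F, ypoly n F -> polyfun F.
Proof.
  induction n as [|n IH]; simpl; intros F HF.
  - apply (polyfun_ext (fun _ _ => 0)); [intros; now rewrite HF | apply polyfun_const].
  - destruct HF as (c & F1 & Hc & HF1 & EF). apply IH in HF1.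
    apply (polyfun_ext (fun x y => c x * y ^ n + F1 x y)); [intros; now rewrite EF|]. polyfun_tac.
Qed.

Lemma polyfun_ypoly F : polyfun F -> exists n, ypoly n F.
Proof.
  revert F; apply polyfun_ind.
  - intros F G E [n H]; exists n; revert H; now apply ypoly_ext.
  - exists O; now simpl.
  - intros c i j F _ [n H]; exists (S j + n)%nat; apply ypoly_plus.
    + apply (ypoly_le (S j)); [lia|]. exists (fun x => c * x ^ i), (fun _ _ => 0).
      split; [polyfun_tac|]. split; [apply (ypoly_le 0); [lia | now simpl] | intros; ring].
    + revert H; apply ypoly_le; lia.
Qed.

Definition poly_ideal (J : fn2 -> Prop) : Prop :=
  (forall p, J p -> polyfun p) /\
  J (fun _ _ => 0) /\
  (forall p q, J p -> J q -> J (fun x y => p x y + q x y)) /\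
  (forall a p, polyfun a -> J p -> J (fun x y => a x y * p x y)).

(** Euclid's algorithm over the rational functions in [x], without fractions: [d] has least
    [y]-degree in [J], so a remainder of pseudo-division by [d], being in [J], is zero. The bound
    [n <= n0] serves the later induction on degree in the count of isolated zeros. *)
Lemma poly_ideal_pseudo_generator J : poly_ideal J ->
  forall p0 n0, J p0 -> ypoly n0 p0 -> (exists x y, p0 x y <> 0) ->
  exists d c n, J d /\ ypoly n d /\ (n <= n0)%nat /\ (exists x y, d x y <> 0) /\
    polyfun (fun x _ => c x) /\ (exists x, c x <> 0) /\
    forall p, J p -> exists m p1, polyfun p1 /\ forall x y, c x ^ m * p x y = d x y * p1 x y.
Proof.
  intros (Jp & J0 & Jplus & Jmul).
  set (Q := fun n => exists d, J d /\ ypoly n d /\ exists x y, d x y <> 0).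
  assert (Hmin : forall n, Q n -> exists n', (n' <= n)%nat /\ Q n' /\ forall m, (m < n')%nat -> ~ Q m).
  { intros n; induction n as [n IH] using (well_founded_induction lt_wf); intros Hn.
    destruct (classic (exists m, (m < n)%nat /\ Q m)) as [(m & Hm & HQ)|N].
    - destruct (IH m Hm HQ) as (n' & ? & ? & ?); exists n'; split; [lia|]; now split.
    - exists n; split; [lia|]; split; [exact Hn|]. intros m Hm HQ; apply N; now exists m. }
  intros p0 n0 Hp0 Hn0 Hz0.
  destruct (Hmin n0) as (n & Hle & (d & Jd & Yd & Zd) & Hlt); [now exists p0|].
  destruct n as [|n]; [destruct Zd as (x & y & Zd); now destruct Zd|].
  destruct Yd as (c & G & Hc & HG & Ed).
  assert (Pd : polyfun d) by now apply Jp.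
  exists d, c, (S n); split; [exact Jd|]; split; [now exists c, G|]; split; [exact Hle|]; split; [exact Zd|].
  split; [exact Hc|]; split.
  { apply NNPP; intros N. apply (Hlt n); [lia|]. exists d; split; [exact Jd|]; split; [|exact Zd].
    revert HG; apply ypoly_ext; intros x y; rewrite Ed.
    replace (c x) with 0; [ring|]. apply NNPP; intros Z; apply N; exists x; auto. }
  intros p Hp; destruct (polyfun_ypoly p (Jp p Hp)) as [N HN].
  revert p Hp HN; induction N as [|N IH]; intros p Hp HN.
  - exists O, (fun _ _ => 0); split; [apply polyfun_const|]; intros; rewrite HN; ring.
  - destruct (Nat.lt_ge_cases N n) as [L|L].
    + exists O, (fun _ _ => 0); split; [apply polyfun_const|]. intros x y.
      replace (p x y) with 0; [ring|]. symmetry; apply NNPP; intros Z.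
      apply (Hlt (S N)); [lia|]. exists p; split; [exact Hp|]; split; [exact HN|]. now exists x, y.
    + destruct HN as (a & P & Ha & HP & EP).
      (* The multiple of [d] cancels the top power of [y]; each such round costs one factor [c],
         hence the exponent [m]. *)
      destruct (IH (fun x y => c x * p x y + (- a x * y ^ (N - n)) * d x y)) as (m & p1 & H1 & E1).
      * apply (Jplus (fun x y => c x * p x y) (fun x y => (- a x * y ^ (N - n)) * d x y)).
        -- apply (Jmul (fun x _ => c x)); [exact Hc | exact Hp].
        -- apply (Jmul (fun x y => - a x * y ^ (N - n))); [polyfun_tac | exact Jd].
      * apply (ypoly_ext _ (fun x y => c x * P x y + y ^ (N - n) * (- a x * G x y))).
        { intros x y; rewrite EP, Ed. replace N with (n + (N - n))%nat at 2 by lia.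
          rewrite pow_add; ring. }
        apply ypoly_plus; [now apply ypoly_scal|].
        replace N with (n + (N - n))%nat at 1 by lia.
        apply ypoly_shift, (ypoly_scal n (fun x => - a x)); [polyfun_tac | exact HG].
      * exists (S m), (fun x y => p1 x y + c x ^ m * a x * y ^ (N - n)); split; [polyfun_tac|].
        intros x y; specialize (E1 x y); simpl. ring_simplify in E1. ring_simplify. lra.
Qed.

(** Termination is measured on the row [y = y0], where [F] is not identically zero: every line split
    off lowers the degree of that restriction. *)
Lemma extract_vertical_lines_deg y0 D : forall F, polyfun F -> upoly D (fun x => F x y0) ->
  (exists x, F x y0 <> 0) ->
  exists l F2, polyfun F2 /\ (forall x y, F x y = rootprod l x * F2 x y) /\
    forall r, exists y, F2 r y <> 0.
Proof.
  induction D as [|D IH]; intros F HF HD [x0 Hx0]; [now destruct Hx0|].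
  destruct (classic (exists r, forall y, F r y = 0)) as [[r Hr]|N].
  - destruct (polyfun_taylor F r HF) as (F1 & HF1 & E).
    destruct (upoly_taylor D _ HD r) as (g & Hg & Eg).
    destruct (IH F1 HF1) as (l & F2 & H2 & E2 & Hn).
    + assert (Pg := upoly_polyfun _ _ Hg). revert Hg; apply upoly_ext. intros x.
      apply Rminus_diag_uniq.
      apply (polyfun_integral_1 (fun x => x - r) (fun x => g x - F1 x y0)).
      * polyfun_tac.
      * polyfun_tac.
      * intros t; generalize (Eg t), (E t y0), (Hr y0); intros; nra.
      * exists (r + 1); lra.
    + exists x0; intros Z; apply Hx0; rewrite E, Hr, Z; ring.
    + exists (r :: l), F2; split; [exact H2|]; split; [|exact Hn].
      intros x y; simpl; rewrite E, Hr, E2; ring.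
  - exists [], F; split; [exact HF|]; split; [intros; simpl; ring|].
    intros r; apply NNPP; intros Z; apply N; exists r; intros y; apply NNPP; intros Hy; apply Z; now exists y.
Qed.

Lemma extract_vertical_lines F : polyfun F -> (exists x y, F x y <> 0) ->
  exists l F2, polyfun F2 /\ (forall x y, F x y = rootprod l x * F2 x y) /\
    forall r, exists y, F2 r y <> 0.
Proof.
  intros HF (x0 & y0 & H0). destruct (polyfun_upoly F y0 HF) as [D HD].
  apply (extract_vertical_lines_deg y0 D F HF HD); now exists x0.
Qed.

(** On [x = r] the product [d P] vanishes and [d] does not vanish identically, so [P] is zero there
    and contains the factor [x - r]. *)
Lemma polyfun_divide_line F d r P : polyfun F -> polyfun d -> polyfun P ->
  (exists y, d r y <> 0) -> (forall x y, (x - r) * F x y = d x y * P x y) ->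
  exists P1, polyfun P1 /\ forall x y, F x y = d x y * P1 x y.
Proof.
  intros HF Hd HP Hr E.
  assert (Z : forall y, P r y = 0).
  { apply (polyfun_integral_1 (fun y => d r y)); [now apply polyfun_fix_fst | now apply polyfun_fix_fst | | exact Hr].
    intros y; rewrite <- E; ring. }
  destruct (polyfun_taylor P r HP) as (P1 & H1 & E1). exists P1; split; [exact H1|].
  apply (polyfun_cancel F (fun x y => d x y * P1 x y) r); [exact HF | polyfun_tac |].
  intros x y; rewrite E, E1, Z; ring.
Qed.

(* Gauss' lemma, for the linear primes [x - r] only. *)
Lemma polyfun_divide_lines d l : polyfun d -> (forall r, exists y, d r y <> 0) ->
  forall F P, polyfun F -> polyfun P ->
  (forall x y, rootprod l x * F x y = d x y * P x y) ->
  exists P1, polyfun P1 /\ forall x y, F x y = d x y * P1 x y.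
Proof.
  intros Hd Hr; induction l as [|r l IH]; intros F P HF HP E.
  - exists P; split; [exact HP|]; intros x y; rewrite <- E; simpl; ring.
  - assert (Hl := polyfun_rootprod l).
    destruct (polyfun_divide_line (fun x y => rootprod l x * F x y) d r P) as (P1 & H1 & E1).
    + polyfun_tac.
    + exact Hd.
    + exact HP.
    + apply Hr.
    + intros x y; rewrite <- E; simpl; ring.
    + exact (IH F P1 HF H1 E1).
Qed.

(** The zero-free factor [c] is what remains of a denominator after its real linear factors are
    cancelled; it does not affect where a quotient is regular. *)
Definition divides_up_to_unit (d p : fn2) : Prop :=
  exists c p', polyfun c /\ polyfun p' /\ (forall x y, c x y <> 0) /\
    forall x y, c x y * p x y = d x y * p' x y.

(** The pseudo-generator divides each [p] up to a power of its leading coefficient. Once [d] is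
    freed of vertical lines, the real roots of that coefficient can be cancelled, and the rest of it
    has no zeros. *)
Lemma poly_ideal_common_divisor J : poly_ideal J -> (exists p x y, J p /\ p x y <> 0) ->
  exists d l, polyfun d /\ (exists x y, d x y <> 0) /\
    J (fun x y => rootprod l x * d x y) /\ (forall p, J p -> divides_up_to_unit d p).
Proof.
  intros HJ (p0 & x0 & y0 & Hp0 & H0). assert (Jp := proj1 HJ).
  destruct (polyfun_ypoly p0 (Jp _ Hp0)) as [n0 Hn0].
  destruct (poly_ideal_pseudo_generator J HJ p0 n0 Hp0 Hn0) as (d0 & c & n & Jd & _ & _ & Zd & Hc & Zc & Hdiv);
    [now exists x0, y0|].
  destruct (extract_vertical_lines d0 (Jp _ Jd) Zd) as (l & d & Hd & Ed & Hr).
  destruct (polyfun_factor c Hc Zc) as (lc & c0 & Hc0 & Nc0 & Ec).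
  exists d, l; split; [exact Hd|]; split; [destruct (Hr 0) as [y Hy]; now exists 0, y|].
  split; [revert Jd; apply fn2_ext, Ed|].
  intros p Hp; destruct (Hdiv p Hp) as (m & p1 & Hp1 & E).
  assert (Pp := Jp _ Hp). assert (Hl := polyfun_rootprod l).
  destruct (polyfun_divide_lines d (concat (repeat lc m)) Hd Hr
    (fun x y => c0 x ^ m * p x y) (fun x y => rootprod l x * p1 x y)) as (p' & Hp' & E').
  - polyfun_tac.
  - polyfun_tac.
  - intros x y.
    replace (rootprod (concat (repeat lc m)) x) with (rootprod lc x ^ m).
    { replace (d x y * (rootprod l x * p1 x y)) with (d0 x y * p1 x y) by (rewrite Ed; ring).
      rewrite <- E, Ec, Rpow_mult_distr; ring. }
    clear; induction m as [|m IH]; simpl; [reflexivity|]. now rewrite rootprod_app, IH.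
  - exists (fun x _ => c0 x ^ m), p'; split; [polyfun_tac|]; split; [exact Hp'|]; split; [|exact E'].
    intros x _; now apply pow_nonzero.
Qed.

(** As long as all quotients by [d] vanish on some line [x = r] with [r] in [l], the factor [x - r]
    moves from the list into [d]. The list gets shorter, and each root that survives has a witness
    [p]. *)
Lemma poly_ideal_greatest_divisor J : poly_ideal J -> (exists p x y, J p /\ p x y <> 0) ->
  exists d l, polyfun d /\ (exists x y, d x y <> 0) /\
    J (fun x y => rootprod l x * d x y) /\ (forall p, J p -> divides_up_to_unit d p) /\
    forall r, In r l -> exists p c p', J p /\ polyfun c /\ polyfun p' /\
      (forall x y, c x y * p x y = d x y * p' x y) /\ exists y, p' r y <> 0.
Proof.
  intros HJ HN. destruct (poly_ideal_common_divisor J HJ HN) as (d & l & Hd & Zd & Jl & Hdiv).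
  remember (length l) as n eqn:Hn. revert d l Hn Hd Zd Jl Hdiv.
  induction n as [|n IH]; intros d l Hn Hd Zd Jl Hdiv.
  { exists d, l; repeat (split; [assumption|]). destruct l; [easy | discriminate]. }
  destruct (classic (exists r, In r l /\ forall p c p', J p -> polyfun c -> polyfun p' ->
    (forall x y, c x y * p x y = d x y * p' x y) -> forall y, p' r y = 0)) as [(r & Hr & Hz)|N].
  - destruct (in_split r l Hr) as (l1 & l2 & ->).
    destruct Zd as (x1 & y1 & Zd).
    apply (IH (fun x y => d x y * (x - r)) (l1 ++ l2)).
    + rewrite length_app in *; simpl in Hn; lia.
    + polyfun_tac.
    + destruct (classic (exists x y, d x y * (x - r) <> 0)) as [?|Nz]; [assumption|].
      destruct Zd; revert x1 y1. apply (polyfun_cancel d (fun _ _ => 0) r Hd); [apply polyfun_const|].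
      intros x y; apply NNPP; intros Z; apply Nz; exists x, y; lra.
    + revert Jl; apply fn2_ext; intros x y; rewrite !rootprod_app; simpl; ring.
    + intros p Hp; destruct (Hdiv p Hp) as (c & p' & Hc & Hp' & Nc & E).
      destruct (polyfun_taylor p' r Hp') as (p1 & Hp1 & E1).
      exists c, p1; repeat (split; [assumption|]). intros x y; rewrite E, E1, (Hz p c p' Hp Hc Hp' E); ring.
  - exists d, l; repeat (split; [assumption|]). intros r Hr; apply NNPP; intros Nr; apply N.
    exists r; split; [exact Hr|]. intros p c p' Hp Hc Hp' E y; apply NNPP; intros Hy; apply Nr.
    exists p, c, p'; repeat (split; [assumption|]). now exists y.
Qed.

(** The roots in [l] are traded for a function of [y] alone: one keeps [b d] congruent to
    [al (rootprod l) d] modulo [J] while the list grows. For the full list the second term is itself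
    in [J]. *)
Lemma poly_ideal_divisor J : poly_ideal J -> (exists p x y, J p /\ p x y <> 0) ->
  exists d l b, polyfun d /\ (exists x y, d x y <> 0) /\
    (forall p, J p -> divides_up_to_unit d p) /\
    J (fun x y => rootprod l x * d x y) /\
    polyfun (fun y _ => b y) /\ (exists y, b y <> 0) /\ J (fun x y => b y * d x y).
Proof.
  intros HJ HN. destruct (poly_ideal_greatest_divisor J HJ HN) as (d & l & Hd & Zd & Jl & Hdiv & Hl).
  destruct HJ as (Jp & J0 & Jplus & Jmul).
  cut (exists b al, polyfun (fun y _ => b y) /\ (exists y, b y <> 0) /\ polyfun al /\
    J (fun x y => b y * d x y - al x y * (rootprod l x * d x y))).
  { intros (b & al & Hb & Zb & Hal & H). exists d, l, b; repeat (split; [assumption|]).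
    apply (fn2_ext J (fun x y => (b y * d x y - al x y * (rootprod l x * d x y)) + al x y * (rootprod l x * d x y))).
    { intros; ring. }
    apply (Jplus _ (fun x y => al x y * (rootprod l x * d x y)) H). now apply Jmul. }
  clear Jl; induction l as [|r l IH].
  - exists (fun _ => 1), (fun _ _ => 1). split; [apply polyfun_const|]; split; [exists 0; lra|].
    split; [apply polyfun_const|]. revert J0; apply fn2_ext; intros; simpl; ring.
  - destruct IH as (b & al & Hb & (y0 & Zb) & Hal & H); [intros; apply Hl; now right|].
    destruct (Hl r) as (p & c & p' & Hp & Hc & Hp' & E & Zr); [now left|].
    destruct (polyfun_taylor p' r Hp') as (s & Hs & Es).
    assert (Hrl := polyfun_rootprod l).
    (* Multiply the congruence by [p' r y = p' - (x - r) s]. The part with [p'] is a multiple of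
       [c p], which is in [J], and the other part carries the new factor [x - r]. *)
    exists (fun y => b y * p' r y), (fun x y => - al x y * s x y).
    split; [polyfun_tac|]; split; [|split; [polyfun_tac|]].
    { apply NNPP; intros N. destruct Zr as [y1 Zr]; apply Zr.
      apply (polyfun_integral_1 b (fun y => p' r y)).
      - exact Hb.
      - now apply polyfun_fix_fst.
      - intros y; apply NNPP; intros Z; apply N; now exists y.
      - now exists y0. }
    apply (fn2_ext J (fun x y => p' r y * (b y * d x y - al x y * (rootprod l x * d x y))
        + (al x y * rootprod l x * c x y) * p x y)).
    + intros x y; simpl.
      replace (al x y * rootprod l x * c x y * p x y) with (al x y * rootprod l x * (c x y * p x y)) by ring.
      rewrite E, (Es x y); ring.
    + apply (Jplus (fun x y => p' r y * (b y * d x y - al x y * (rootprod l x * d x y)))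
        (fun x y => (al x y * rootprod l x * c x y) * p x y)).
      * apply (Jmul (fun x y => p' r y)); [polyfun_tac | exact H].
      * apply (Jmul (fun x y => al x y * rootprod l x * c x y)); [polyfun_tac | exact Hp].
Qed.

(** * Isolated zeros of polynomials *)

Lemma is_derive_R_const (c t : R) : is_derive (fun _ : R => c) t 0.
Proof. exact (is_derive_const (K := R_AbsRing) (V := R_NormedModule) c t). Qed.

Lemma is_derive_R_id (t : R) : is_derive (fun t : R => t) t 1.
Proof. exact (is_derive_id (K := R_AbsRing) t). Qed.

(** The chain rule along arbitrary curves gives both the partial derivatives in the plane and the
    derivatives in the charts. *)
Lemma polyfun_derive F : polyfun F -> exists Fx Fy, polyfun Fx /\ polyfun Fy /\
  forall (A B : R -> R) t A' B', is_derive A t A' -> is_derive B t B' ->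
    is_derive (fun t => F (A t) (B t)) t (Fx (A t) (B t) * A' + Fy (A t) (B t) * B').
Proof.
  revert F; apply polyfun_ind.
  - intros F G E; now rewrite (fn2_eq F G E).
  - exists (fun _ _ => 0), (fun _ _ => 0); split; [apply polyfun_const|]; split; [apply polyfun_const|].
    intros A B t A' B' _ _; replace (0 * A' + 0 * B') with 0 by ring. apply is_derive_R_const.
  - intros c i j F _ (Fx & Fy & Hx & Hy & H).
    exists (fun x y => c * (INR i * x ^ pred i) * y ^ j + Fx x y),
      (fun x y => c * x ^ i * (INR j * y ^ pred j) + Fy x y).
    split; [polyfun_tac|]; split; [polyfun_tac|].
    intros A B t A' B' HA HB. specialize (H A B t A' B' HA HB).
    assert (HAi := is_derive_pow A i t A' HA). assert (HBj := is_derive_pow B j t B' HB).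
    assert (M : is_derive (fun t => c * A t ^ i * B t ^ j) t
      ((c * (INR i * A' * A t ^ pred i)) * B t ^ j + (c * A t ^ i) * (INR j * B' * B t ^ pred j))).
    { apply (is_derive_mult (fun t => c * A t ^ i) (fun t => B t ^ j)); [| exact HBj | intros; apply Rmult_comm].
      apply (is_derive_scal (fun t => A t ^ i) t c), HAi. }
    replace (_ + _) with (((c * (INR i * A' * A t ^ pred i)) * B t ^ j + (c * A t ^ i) * (INR j * B' * B t ^ pred j))
      + (Fx (A t) (B t) * A' + Fy (A t) (B t) * B')) by ring.
    apply (is_derive_plus (fun t => c * A t ^ i * B t ^ j) (fun t => F (A t) (B t))); [exact M | exact H].
Qed.

Lemma polyfun_partials F : polyfun F -> exists Fx Fy, polyfun Fx /\ polyfun Fy /\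
  (forall x y, is_derive (fun t => F t y) x (Fx x y)) /\
  (forall x y, is_derive (fun t => F x t) y (Fy x y)).
Proof.
  intros HF; destruct (polyfun_derive F HF) as (Fx & Fy & Hx & Hy & H).
  exists Fx, Fy; split; [exact Hx|]; split; [exact Hy|]; split; intros x y.
  - replace (Fx x y) with (Fx x y * 1 + Fy x y * 0) by ring.
    apply (H (fun t => t) (fun _ => y)); [apply is_derive_R_id | apply is_derive_R_const].
  - replace (Fy x y) with (Fx x y * 0 + Fy x y * 1) by ring.
    apply (H (fun _ => x) (fun t => t)); [apply is_derive_R_const | apply is_derive_R_id].
Qed.

Lemma polyfun_continuity F x y : polyfun F -> continuity_2d_pt F x y.
Proof.
  revert F; apply polyfun_ind.
  - intros F G E; apply continuity_2d_pt_ext, E.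
  - apply continuity_2d_pt_const.
  - intros c i j F _ H. apply continuity_2d_pt_plus; [|exact H].
    assert (P : forall (f : fn2) n, continuity_2d_pt f x y -> continuity_2d_pt (fun x y => f x y ^ n) x y).
    { intros f n Hf; induction n as [|n IH]; [exact (continuity_2d_pt_const x y 1)|].
      apply (continuity_2d_pt_mult f (fun x y => f x y ^ n) x y Hf IH). }
    apply continuity_2d_pt_mult; [apply continuity_2d_pt_mult; [apply continuity_2d_pt_const|]|].
    + apply (P (fun x _ => x)), continuity_2d_pt_id1.
    + apply (P (fun _ y => y)), continuity_2d_pt_id2.
Qed.

Lemma ypoly_derive n : forall F, ypoly n F ->
  exists Fy, ypoly (pred n) Fy /\ forall x y, is_derive (fun t => F x t) y (Fy x y).
Proof.
  induction n as [|n IH]; intros F HF.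
  - exists (fun _ _ => 0); split; [now simpl|]. intros x y.
    apply (is_derive_ext (fun _ => 0)); [intros; now rewrite HF | apply is_derive_R_const].
  - destruct HF as (c & G & Hc & HG & E). destruct (IH G HG) as (Gy & HGy & HD).
    exists (fun x y => c x * INR n * y ^ pred n + Gy x y); split.
    + simpl. destruct n as [|n]; simpl pred in *.
      * intros x y; simpl; rewrite HGy; ring.
      * exists (fun x => c x * INR (S n)), Gy; split; [polyfun_tac|]; now split.
    + intros x y. apply (is_derive_ext (fun t => c x * t ^ n + G x t)); [intros; now rewrite E|].
      apply (is_derive_plus (fun t => c x * t ^ n) (G x)); [|apply HD].
      replace (c x * INR n * y ^ pred n) with (c x * (INR n * 1 * y ^ pred n)) by ring.
      apply (is_derive_scal (fun t => t ^ n) y (c x)), (is_derive_pow (fun t => t) n y 1), is_derive_R_id.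
Qed.

(** Allowing a list in place of the single point [(a, b)] avoids shrinking neighbourhoods: in the
    application the list consists of the blown-up points of some [g]. *)
Definition locally_finite_zeros (F : fn2) (a b : R) : Prop :=
  exists l : list (R * R), locally_2d (fun u v => F u v = 0 -> In (u, v) l) a b.

Lemma not_locally_finite_zeros_vertical F a b del : 0 < del ->
  (forall v, Rabs (v - b) < del -> F a v = 0) -> ~ locally_finite_zeros F a b.
Proof.
  intros Hd Hz (l & eps & Hl).
  destruct (interval_avoids_list (map snd l) b (b + Rmin del eps)) as (v & Hv & Nv).
  { assert (0 < Rmin del eps) by (apply Rmin_glb_lt; [lra | apply cond_pos]). lra. }
  assert (H1 := Rmin_l del eps). assert (H2 := Rmin_r del eps).
  apply Nv. change v with (snd (a, v)). apply in_map, Hl.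
  - rewrite Rminus_diag, Rabs_R0; apply cond_pos.
  - apply Rabs_def1; lra.
  - apply Hz, Rabs_def1; lra.
Qed.

Lemma sign_change_of_derive (f : R -> R) b l del : is_derive f b l -> f b = 0 -> l <> 0 -> 0 < del ->
  exists eta, 0 < eta < del /\ f (b - eta) * f (b + eta) < 0.
Proof.
  intros D Hb Hl Hd. apply is_derive_Reals in D.
  assert (Pl : 0 < Rabs l) by now apply Rabs_pos_lt.
  destruct (D (Rabs l) Pl) as [d1 H1].
  assert (P1 := cond_pos d1).
  set (eta := Rmin del d1 / 2).
  assert (E1 := Rmin_l del d1). assert (E2 := Rmin_r del d1).
  assert (E3 : 0 < Rmin del d1) by (apply Rmin_glb_lt; lra).
  assert (He : 0 < eta < del /\ eta < d1) by (unfold eta; lra).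
  assert (K : forall h, h <> 0 -> Rabs h < d1 -> 0 < f (b + h) / h * l).
  { intros h Hh Hh1. specialize (H1 h Hh Hh1). rewrite Hb, Rminus_0_r in H1.
    apply Rabs_def2 in H1. unfold Rabs in H1; destruct (Rcase_abs l); nra. }
  exists eta; split; [lra|].
  assert (K1 := K eta). assert (K2 := K (- eta)).
  rewrite Rabs_Ropp, Rabs_pos_eq in K2 by lra. rewrite Rabs_pos_eq in K1 by lra.
  specialize (K1 ltac:(lra) ltac:(lra)). specialize (K2 ltac:(lra) ltac:(lra)).
  replace (b - eta) with (b + - eta) by ring.
  set (u := f (b + eta)) in *. set (v := f (b + - eta)) in *.
  assert (Q1 : 0 < u * l).
  { replace (u * l) with (u / eta * l * eta) by (field; lra). apply Rmult_lt_0_compat; lra. }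
  assert (Q2 : 0 < - (v * l)).
  { replace (- (v * l)) with (v / - eta * l * eta) by (field; lra). apply Rmult_lt_0_compat; lra. }
  assert (Q3 := Rmult_lt_0_compat _ _ Q1 Q2). assert (0 < l * l) by nra. nra.
Qed.

(** Takes the place of the implicit function theorem: the sign change of [F] across [b] on the line
    over [a] persists on nearby vertical lines, and the intermediate value theorem puts a zero on
    each of them. *)
Lemma not_locally_finite_zeros_smooth F l a b : polyfun F -> F a b = 0 ->
  is_derive (fun t => F a t) b l -> l <> 0 -> ~ locally_finite_zeros F a b.
Proof.
  intros HF Hab D Hl (L & del & HL).
  destruct (sign_change_of_derive _ b l del D Hab Hl (cond_pos del)) as (eta & Heta & Hneg).
  assert (HG : polyfun (fun x _ => F x (b - eta) * F x (b + eta))) by polyfun_tac.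
  assert (Hpos : 0 < - (F a (b - eta) * F a (b + eta))) by lra.
  destruct (polyfun_continuity _ a 0 HG (mkposreal _ Hpos)) as [d1 H1]; simpl in H1.
  assert (P1 := cond_pos d1). assert (P2 := cond_pos del).
  assert (E3 : 0 < Rmin del d1) by (apply Rmin_glb_lt; lra).
  destruct (interval_avoids_list (map fst L) a (a + Rmin del d1)) as (x & Hx & Nx); [lra|].
  assert (E1 := Rmin_l del d1). assert (E2 := Rmin_r del d1).
  specialize (H1 x 0). rewrite Rminus_diag, Rabs_R0 in H1.
  specialize (H1 ltac:(apply Rabs_def1; lra) P1). apply Rabs_def2 in H1.
  destruct (polyfun_partials F HF) as (Fx & Fy & _ & _ & _ & HFy).
  destruct (IVT_cor (fun t => F x t) (b - eta) (b + eta)) as (z & Hz & Ez).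
  - intros t; apply derivable_continuous_pt. exists (Fy x t). apply is_derive_Reals, HFy.
  - lra.
  - lra.
  - apply Nx. change x with (fst (x, z)). apply in_map, HL; [apply Rabs_def1; lra | apply Rabs_def1; lra | exact Ez].
Qed.

(** Either [F] has finitely many zeros on the line, or it vanishes on all of it and no zero there is
    isolated. *)
Lemma isolated_zeros_on_lines F : polyfun F -> forall l, exists L, forall a b,
  In a l -> F a b = 0 -> locally_finite_zeros F a b -> In (a, b) L.
Proof.
  intros HF; induction l as [|r l [L IH]]; [exists []; intros; easy|].
  destruct (classic (exists y, F r y <> 0)) as [Hr|Hr].
  - destruct (polyfun_finite_roots (fun y => F r y)) as [l' Hl']; [now apply polyfun_fix_fst | exact Hr |].
    exists (map (pair r) l' ++ L). intros a b [->|Ha] Hab Hf; apply in_or_app.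
    + left; apply in_map, Hl', Hab.
    + right; now apply IH.
  - exists L. intros a b [->|Ha] Hab Hf; [|now apply IH]. exfalso; revert Hf.
    apply (not_locally_finite_zeros_vertical F a b 1); [lra|].
    intros v _; apply NNPP; intros Z; apply Hr; now exists v.
Qed.

(* Generically in [x], a zero of [F] where [F_y] does not vanish lies on a branch of zeros, and the
   common zeros of [F] and [F_y] are the zeros of their gcd, whose degree in [y] is smaller. *)
Lemma isolated_zeros_finite_deg n : forall F, ypoly n F -> (exists x y, F x y <> 0) ->
  exists L, forall a b, F a b = 0 -> locally_finite_zeros F a b -> In (a, b) L.
Proof.
  induction n as [|n IH]; intros F HF (x0 & y0 & Z0); [now destruct Z0|].
  assert (PF := ypoly_polyfun _ _ HF).
  destruct (ypoly_derive _ F HF) as (Fy & HFy & HD); simpl in HFy.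
  assert (PFy := ypoly_polyfun _ _ HFy).
  destruct (classic (exists x y, Fy x y <> 0)) as [ZFy|N].
  - set (J := fun p : fn2 => exists A B, polyfun A /\ polyfun B /\
      forall x y, p x y = A x y * F x y + B x y * Fy x y).
    assert (HJ : poly_ideal J).
    { split; [|split; [|split]].
      - intros p (A & B & HA & HB & E). apply (polyfun_ext (fun x y => A x y * F x y + B x y * Fy x y)); [now intros; rewrite E|]. polyfun_tac.
      - exists (fun _ _ => 0), (fun _ _ => 0); split; [apply polyfun_const|]; split; [apply polyfun_const|]; intros; ring.
      - intros p q (A & B & HA & HB & E) (A' & B' & HA' & HB' & E').
        exists (fun x y => A x y + A' x y), (fun x y => B x y + B' x y); split; [polyfun_tac|]; split; [polyfun_tac|].
        intros; rewrite E, E'; ring.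
      - intros a p Ha (A & B & HA & HB & E).
        exists (fun x y => a x y * A x y), (fun x y => a x y * B x y); split; [polyfun_tac|]; split; [polyfun_tac|].
        intros; rewrite E; ring. }
    destruct (poly_ideal_pseudo_generator J HJ Fy n) as (d & c & n' & (A & B & HA & HB & Ed) & Yd & Hn & Zd & Hc & Zc & Hdiv).
    + exists (fun _ _ => 0), (fun _ _ => 1); split; [apply polyfun_const|]; split; [apply polyfun_const|]; intros; ring.
    + exact HFy.
    + exact ZFy.
    + destruct (IH d (ypoly_le _ _ _ Hn Yd) Zd) as [L1 HL1].
      destruct (polyfun_finite_roots c Hc Zc) as [lr Hlr].
      destruct (isolated_zeros_on_lines F PF lr) as [L2 HL2].
      exists (L1 ++ L2). intros a b Hab Hf. apply in_or_app.
      (* Pseudo-division tells nothing over the roots of [c]; these are finitely many lines, covered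
         by [L2]. *)
      destruct (Req_dec (c a) 0) as [Ca|Ca]; [right; apply HL2; auto | left].
      destruct (Req_dec (Fy a b) 0) as [Fab|Fab].
      * apply HL1; [rewrite Ed, Hab, Fab; ring|].
        (* Where [c] is nonzero, zeros of [d] are zeros of [F], so [d] inherits local finiteness at
           [(a, b)]. *)
        destruct Hf as [l Hl]; exists l.
        destruct (Hdiv F) as (m & p1 & _ & E).
        { exists (fun _ _ => 1), (fun _ _ => 0); split; [apply polyfun_const|]; split; [apply polyfun_const|]; intros; ring. }
        assert (Hc0 := continuity_2d_pt_neq_0 _ a b (polyfun_continuity _ a b Hc) Ca).
        generalize (locally_2d_and _ _ _ _ Hl Hc0); apply locally_2d_impl, locally_2d_forall.
        intros u v [H1 H2] Z; apply H1.
        specialize (E u v); rewrite Z, Rmult_0_l in E.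
        destruct (Rmult_integral _ _ E) as [Q|Q]; [|exact Q]. now destruct (pow_nonzero _ m H2).
      * exfalso; revert Hf. apply (not_locally_finite_zeros_smooth F (Fy a b)); auto.
  (* Here [F] does not depend on [y], so its zeros fill vertical lines. *)
  - exists []. intros a b Hab Hf. revert Hf.
    apply (not_locally_finite_zeros_vertical F a b 1); [lra|]. intros v _.
    assert (Hz : forall t, is_derive (fun t => F a t) t 0).
    { intros t; replace 0 with (Fy a t); [apply HD|]. apply NNPP; intros Z; apply N; now exists a, t. }
    destruct (Rtotal_order v b) as [Hv|[->|Hv]]; [|exact Hab|].
    + rewrite <- Hab; exact (eq_is_derive (fun t => F a t) v b (fun t _ => Hz t) Hv).
    + rewrite <- Hab; symmetry; exact (eq_is_derive (fun t => F a t) b v (fun t _ => Hz t) Hv).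
Qed.

Lemma isolated_zeros_finite F : polyfun F -> (exists x y, F x y <> 0) ->
  exists L, forall a b, F a b = 0 -> locally_finite_zeros F a b -> In (a, b) L.
Proof. intros HF; destruct (polyfun_ypoly F HF) as [n Hn]; exact (isolated_zeros_finite_deg n F Hn). Qed.

(** * Local differentiability of class C^k *)

Definition pdx (f : fn2) : fn2 := fun x y => Derive (fun t => f t y) x.
Definition pdy (f : fn2) : fn2 := fun x y => Derive (fun t => f x t) y.

(** A local form of [Ck], so that different points may be treated by different arguments. The total
    function [Derive] supplies one global candidate for each partial derivative, so the local
    results glue directly. *)
Fixpoint CkAt (k : nat) (f : fn2) (x y : R) : Prop :=
  match k with
  | O => locally_2d (continuity_2d_pt f) x y
  | S k' => locally_2d (continuity_2d_pt f) x y /\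
      locally_2d (fun u v => ex_derive (fun t => f t v) u /\ ex_derive (fun t => f u t) v) x y /\
      CkAt k' (pdx f) x y /\ CkAt k' (pdy f) x y
  end.

Lemma locally_2d_mono (P Q : R -> R -> Prop) x y :
  (forall u v, P u v -> Q u v) -> locally_2d P x y -> locally_2d Q x y.
Proof. intros H; apply locally_2d_impl, locally_2d_forall, H. Qed.

Lemma locally_2d_near P x y : locally_2d P x y -> locally_2d (locally_2d P) x y.
Proof. apply locally_2d_impl_strong, locally_2d_forall; auto. Qed.

Lemma Derive_fst_ext_loc (f g : fn2) x y : locally_2d (fun u v => f u v = g u v) x y -> pdx f x y = pdx g x y.
Proof. intros H; apply Derive_ext_loc. exact (locally_2d_1d_const_y _ _ _ H). Qed.

Lemma Derive_snd_ext_loc (f g : fn2) x y : locally_2d (fun u v => f u v = g u v) x y -> pdy f x y = pdy g x y.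
Proof. intros H; apply Derive_ext_loc. exact (locally_2d_1d_const_x _ _ _ H). Qed.

Lemma CkAt_cont k f x y : CkAt k f x y -> locally_2d (continuity_2d_pt f) x y.
Proof. destruct k; simpl; tauto. Qed.

Lemma CkAt_ext_loc k : forall f g x y, locally_2d (fun u v => f u v = g u v) x y -> CkAt k f x y -> CkAt k g x y.
Proof.
  induction k as [|k IH]; intros f g x y E.
  - simpl. intros H. generalize (locally_2d_and _ _ _ _ (locally_2d_near _ _ _ E) H).
    apply locally_2d_mono; intros u v [E1 H1]; revert E1 H1; apply continuity_2d_pt_ext_loc.
  - intros (Hc & Hd & Hx & Hy). assert (EE := locally_2d_near _ _ _ E).
    split; [|split; [|split]].
    + generalize (locally_2d_and _ _ _ _ EE Hc).
      apply locally_2d_mono; intros u v [E1 H1]; revert E1 H1; apply continuity_2d_pt_ext_loc.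
    + generalize (locally_2d_and _ _ _ _ EE Hd).
      apply locally_2d_mono; intros u v [E1 [H1 H2]]; split.
      * revert H1; apply ex_derive_ext_loc, (locally_2d_1d_const_y _ _ _ E1).
      * revert H2; apply ex_derive_ext_loc, (locally_2d_1d_const_x _ _ _ E1).
    + revert Hx; apply IH. revert EE; apply locally_2d_mono; intros u v; apply Derive_fst_ext_loc.
    + revert Hy; apply IH. revert EE; apply locally_2d_mono; intros u v; apply Derive_snd_ext_loc.
Qed.

Lemma CkAt_S k : forall f x y, CkAt (S k) f x y -> CkAt k f x y.
Proof.
  induction k as [|k IH]; intros f x y (Hc & Hd & Hx & Hy); [exact Hc|].
  split; [exact Hc|]; split; [exact Hd|]; split; now apply IH.
Qed.

Lemma CkAt_plus k : forall f g x y, CkAt k f x y -> CkAt k g x y -> CkAt k (fun x y => f x y + g x y) x y.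
Proof.
  induction k as [|k IH]; intros f g x y Hf Hg.
  - generalize (locally_2d_and _ _ _ _ Hf Hg); apply locally_2d_mono; intros u v [H1 H2].
    now apply continuity_2d_pt_plus.
  - destruct Hf as (Hc & Hd & Hx & Hy), Hg as (Hc' & Hd' & Hx' & Hy').
    assert (HD := locally_2d_and _ _ _ _ Hd Hd').
    split; [|split; [|split]].
    + generalize (locally_2d_and _ _ _ _ Hc Hc'); apply locally_2d_mono; intros u v [H1 H2].
      now apply continuity_2d_pt_plus.
    + revert HD; apply locally_2d_mono; intros u v [[H1 H2] [H3 H4]]; split.
      * now apply (ex_derive_plus (fun t => f t v) (fun t => g t v)).
      * now apply (ex_derive_plus (fun t => f u t) (fun t => g u t)).
    + apply (CkAt_ext_loc k (fun u v => pdx f u v + pdx g u v)); [|now apply IH].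
      revert HD; apply locally_2d_mono; intros u v [[H1 H2] [H3 H4]]; symmetry.
      now apply (Derive_plus (fun t => f t v) (fun t => g t v)).
    + apply (CkAt_ext_loc k (fun u v => pdy f u v + pdy g u v)); [|now apply IH].
      revert HD; apply locally_2d_mono; intros u v [[H1 H2] [H3 H4]]; symmetry.
      now apply (Derive_plus (fun t => f u t) (fun t => g u t)).
Qed.

Lemma CkAt_mult k : forall f g x y, CkAt k f x y -> CkAt k g x y -> CkAt k (fun x y => f x y * g x y) x y.
Proof.
  induction k as [|k IH]; intros f g x y Hf Hg.
  - generalize (locally_2d_and _ _ _ _ Hf Hg); apply locally_2d_mono; intros u v [H1 H2].
    now apply continuity_2d_pt_mult.
  - assert (Hf0 := CkAt_S _ _ _ _ Hf). assert (Hg0 := CkAt_S _ _ _ _ Hg).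
    destruct Hf as (Hc & Hd & Hx & Hy), Hg as (Hc' & Hd' & Hx' & Hy').
    assert (HD := locally_2d_and _ _ _ _ Hd Hd').
    split; [|split; [|split]].
    + generalize (locally_2d_and _ _ _ _ Hc Hc'); apply locally_2d_mono; intros u v [H1 H2].
      now apply continuity_2d_pt_mult.
    + revert HD; apply locally_2d_mono; intros u v [[H1 H2] [H3 H4]]; split.
      * now apply (ex_derive_mult (fun t => f t v) (fun t => g t v)).
      * now apply (ex_derive_mult (fun t => f u t) (fun t => g u t)).
    + apply (CkAt_ext_loc k (fun u v => pdx f u v * g u v + f u v * pdx g u v));
        [|apply CkAt_plus; now apply IH].
      revert HD; apply locally_2d_mono; intros u v [[H1 H2] [H3 H4]]; symmetry.
      now apply (Derive_mult (fun t => f t v) (fun t => g t v)).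
    + apply (CkAt_ext_loc k (fun u v => pdy f u v * g u v + f u v * pdy g u v));
        [|apply CkAt_plus; now apply IH].
      revert HD; apply locally_2d_mono; intros u v [[H1 H2] [H3 H4]]; symmetry.
      now apply (Derive_mult (fun t => f u t) (fun t => g u t)).
Qed.

Lemma polyfun_CkAt k : forall F x y, polyfun F -> CkAt k F x y.
Proof.
  induction k as [|k IH]; intros F x y HF.
  - apply locally_2d_forall; intros; now apply polyfun_continuity.
  - destruct (polyfun_partials F HF) as (Fx & Fy & Px & Py & Hx & Hy).
    split; [|split; [|split]].
    + apply locally_2d_forall; intros; now apply polyfun_continuity.
    + apply locally_2d_forall; intros u v; split; [exists (Fx u v); apply Hx | exists (Fy u v); apply Hy].
    + apply IH; revert Px; apply polyfun_ext; intros u v; symmetry; apply is_derive_unique, Hx.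
    + apply IH; revert Py; apply polyfun_ext; intros u v; symmetry; apply is_derive_unique, Hy.
Qed.

Lemma CkAt_inv k : forall f x y, CkAt k f x y -> f x y <> 0 -> CkAt k (fun x y => / f x y) x y.
Proof.
  induction k as [|k IH]; intros f x y Hf Hn;
    assert (HN := continuity_2d_pt_neq_0 _ _ _ (locally_2d_singleton _ _ _ (CkAt_cont _ _ _ _ Hf)) Hn).
  - generalize (locally_2d_and _ _ _ _ Hf HN); apply locally_2d_mono; intros u v [H1 H2].
    now apply continuity_2d_pt_inv.
  - assert (Hi := IH f x y (CkAt_S _ _ _ _ Hf) Hn).
    destruct Hf as (Hc & Hd & Hx & Hy).
    assert (HD := locally_2d_and _ _ _ _ Hd HN).
    assert (Hm := polyfun_CkAt k _ x y (polyfun_const (-1))).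
    split; [|split; [|split]].
    + generalize (locally_2d_and _ _ _ _ Hc HN); apply locally_2d_mono; intros u v [H1 H2].
      now apply continuity_2d_pt_inv.
    + revert HD; apply locally_2d_mono; intros u v [[H1 H2] H3]; split.
      * now apply (ex_derive_inv (fun t => f t v)).
      * now apply (ex_derive_inv (fun t => f u t)).
    + apply (CkAt_ext_loc k (fun u v => (-1) * (pdx f u v * (/ f u v * / f u v))));
        [|repeat apply CkAt_mult; assumption].
      revert HD; apply locally_2d_mono; intros u v [[H1 H2] H3]; symmetry.
      unfold pdx; rewrite (Derive_inv (fun t => f t v)) by assumption. field; assumption.
    + apply (CkAt_ext_loc k (fun u v => (-1) * (pdy f u v * (/ f u v * / f u v))));
        [|repeat apply CkAt_mult; assumption].
      revert HD; apply locally_2d_mono; intros u v [[H1 H2] H3]; symmetry.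
      unfold pdy; rewrite (Derive_inv (fun t => f u t)) by assumption. field; assumption.
Qed.

Lemma CkAt_pow k f x y n : CkAt k f x y -> CkAt k (fun x y => f x y ^ n) x y.
Proof.
  intros H; induction n as [|n IH]; [apply (polyfun_CkAt k _ x y (polyfun_const 1))|].
  exact (CkAt_mult k f (fun x y => f x y ^ n) x y H IH).
Qed.

Lemma cont2_continuity f : cont2 f <-> forall x y, continuity_2d_pt f x y.
Proof.
  split; intros H x y.
  - intros eps; destruct (H x y eps (cond_pos eps)) as (del & Hd & Hdel); now exists (mkposreal del Hd).
  - intros eps He; destruct (H x y (mkposreal eps He)) as [del Hdel]; exists del; split; [apply cond_pos | exact Hdel].
Qed.

Lemma Ck_CkAt k : forall f, Ck k f -> forall x y, CkAt k f x y.
Proof.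
  induction k as [|k IH]; intros f Hf x y.
  - apply locally_2d_forall, cont2_continuity, Hf.
  - destruct Hf as (Hc & fx & fy & Hx & Hy & Kx & Ky).
    split; [apply locally_2d_forall, cont2_continuity, Hc|]. split; [|split].
    + apply locally_2d_forall; intros u v; split; [exists (fx u v) | exists (fy u v)]; apply is_derive_Reals; auto.
    + apply (CkAt_ext_loc k fx); [|now apply IH]. apply locally_2d_forall; intros u v; symmetry.
      apply is_derive_unique, is_derive_Reals, Hx.
    + apply (CkAt_ext_loc k fy); [|now apply IH]. apply locally_2d_forall; intros u v; symmetry.
      apply is_derive_unique, is_derive_Reals, Hy.
Qed.

Lemma CkAt_Ck k : forall f, (forall x y, CkAt k f x y) -> Ck k f.
Proof.
  induction k as [|k IH]; intros f Hf.
  - apply cont2_continuity; intros x y; exact (locally_2d_singleton _ _ _ (Hf x y)).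
  - split; [apply cont2_continuity; intros x y; exact (locally_2d_singleton _ _ _ (CkAt_cont _ _ _ _ (Hf x y)))|].
    exists (pdx f), (pdy f); split; [|split; [|split]].
    + intros x y; apply is_derive_Reals, Derive_correct.
      destruct (Hf x y) as (_ & Hd & _); exact (proj1 (locally_2d_singleton _ _ _ Hd)).
    + intros x y; apply is_derive_Reals, Derive_correct.
      destruct (Hf x y) as (_ & Hd & _); exact (proj2 (locally_2d_singleton _ _ _ Hd)).
    + apply IH; intros x y; now destruct (Hf x y) as (_ & _ & ? & _).
    + apply IH; intros x y; now destruct (Hf x y) as (_ & _ & _ & ?).
Qed.

(** Local, in contrast to [regular_at], so as to be stable under [pdx] and [pdy], which are under
    control only where [h] is known to be differentiable. *)
Definition regular_germ (h : fn2) (x y : R) : Prop :=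
  exists p q, polyfun p /\ polyfun q /\ q x y <> 0 /\
    locally_2d (fun u v => q u v * h u v = p u v) x y.

Lemma regular_germ_CkAt k h x y : regular_germ h x y -> CkAt k h x y.
Proof.
  intros (p & q & Hp & Hq & Hn & E).
  apply (CkAt_ext_loc k (fun u v => p u v * / q u v)).
  - generalize (locally_2d_and _ _ _ _ E (continuity_2d_pt_neq_0 _ _ _ (polyfun_continuity q x y Hq) Hn)).
    apply locally_2d_mono; intros u v [E1 N1]; rewrite <- E1; field; exact N1.
  - apply CkAt_mult; [now apply polyfun_CkAt | apply CkAt_inv; [now apply polyfun_CkAt | exact Hn]].
Qed.

(** * Charts of the blowing-up *)

(* [cx s], [cy s] are the offsets from the blown-up point in the two standard charts. *)
Definition cx (s : bool) (u w : R) : R := if s then u else u * w.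
Definition cy (s : bool) (u w : R) : R := if s then u * w else u.

Definition pull (a b : R) (s : bool) (F : fn2) : fn2 :=
  fun u w => F (a + cx s u w) (b + cy s u w).

Lemma polyfun_pull a b s F : polyfun F -> polyfun (pull a b s F).
Proof. intros HF; unfold pull, cx, cy; polyfun_tac. Qed.

Lemma pull_0 a b s F w : pull a b s F 0 w = F a b.
Proof. unfold pull, cx, cy; destruct s; f_equal; ring. Qed.

Definition ucoord (a b : R) (s : bool) : fn2 := fun x y => if s then x - a else y - b.

Lemma polyfun_ucoord a b s : polyfun (ucoord a b s).
Proof. unfold ucoord; polyfun_tac. Qed.

Lemma pull_ucoord a b s u w : ucoord a b s (a + cx s u w) (b + cy s u w) = u.
Proof. unfold ucoord, cx, cy; destruct s; ring. Qed.

Lemma pull_surj a b s x y : ucoord a b s x y <> 0 ->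
  exists w, x = a + cx s (ucoord a b s x y) w /\ y = b + cy s (ucoord a b s x y) w.
Proof.
  unfold ucoord, cx, cy; destruct s; intros H.
  - exists ((y - b) / (x - a)); split; field; exact H.
  - exists ((x - a) / (y - b)); split; field; exact H.
Qed.

(** The coordinate [w] is a quotient of the two offsets in the plane with denominator [u], so [u^n]
    clears [w^j] as soon as [n >= j]. *)
Lemma polyfun_push a b s P : polyfun P -> exists n0, forall n, (n0 <= n)%nat ->
  exists F, polyfun F /\ forall u w, pull a b s F u w = u ^ n * P u w.
Proof.
  revert P; apply polyfun_ind.
  - intros F G E; now rewrite (fn2_eq F G E).
  - exists O; intros n _; exists (fun _ _ => 0); split; [apply polyfun_const | intros; unfold pull; ring].
  - intros c i j P _ (n0 & H). exists (n0 + j)%nat; intros n Hn.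
    destruct (H n) as (F & HF & E); [lia|].
    assert (H1 := polyfun_ucoord a b s). assert (H2 := polyfun_ucoord a b (negb s)).
    exists (fun x y => c * ucoord a b s x y ^ (n - j + i) * ucoord a b (negb s) x y ^ j + F x y).
    split; [polyfun_tac|]. intros u w.
    transitivity (c * u ^ (n - j + i) * (u * w) ^ j + pull a b s F u w).
    + unfold pull at 1. rewrite pull_ucoord. f_equal. f_equal. f_equal.
      unfold ucoord, cx, cy; destruct s; simpl; ring.
    + rewrite E, Rpow_mult_distr. replace (u ^ n) with (u ^ (n - j) * u ^ j) by (rewrite <- pow_add; f_equal; lia).
      rewrite pow_add; ring.
Qed.

Definition chain_partials (F Fx Fy : fn2) : Prop :=
  forall (A B : R -> R) t A' B', is_derive A t A' -> is_derive B t B' ->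
    is_derive (fun t => F (A t) (B t)) t (Fx (A t) (B t) * A' + Fy (A t) (B t) * B').

(** Differentiating in [w] gives [u F_y = u^(m+1) P_w]; differentiating in [u] gives [F_x + w F_y]
    divisible by [u^m]. Hence both partial derivatives lose only one power of [u]. *)
Lemma pull_derive_true a b m F Fx Fy P : polyfun P -> polyfun Fx -> polyfun Fy -> chain_partials F Fx Fy ->
  (forall u w, F (a + u) (b + u * w) = u ^ S m * P u w) ->
  exists P1 P2, polyfun P1 /\ polyfun P2 /\
    (forall u w, Fx (a + u) (b + u * w) = u ^ m * P1 u w) /\
    (forall u w, Fy (a + u) (b + u * w) = u ^ m * P2 u w).
Proof.
  intros HP Hx Hy HF E. destruct (polyfun_partials P HP) as (Pu & Pw & Hu & Hw & Du & Dw).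
  assert (Ew : forall u w, Fy (a + u) (b + u * w) * u = u ^ S m * Pw u w).
  { intros u w.
    assert (D1 : is_derive (fun w => F (a + u) (b + u * w)) w (Fx (a + u) (b + u * w) * 0 + Fy (a + u) (b + u * w) * u)).
    { apply (HF (fun _ => a + u) (fun w => b + u * w)); [apply is_derive_R_const|]. auto_derive; [easy|ring]. }
    assert (D2 : is_derive (fun w => F (a + u) (b + u * w)) w (u ^ S m * Pw u w)).
    { apply (is_derive_ext (fun w => u ^ S m * P u w)); [intros; now rewrite E|].
      apply (is_derive_scal (fun w => P u w)), Dw. }
    apply is_derive_unique in D1, D2. lra. }
  assert (Eu : forall u w, Fx (a + u) (b + u * w) + Fy (a + u) (b + u * w) * w = INR (S m) * u ^ m * P u w + u ^ S m * Pu u w).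
  { intros u w.
    assert (D1 : is_derive (fun u => F (a + u) (b + u * w)) u (Fx (a + u) (b + u * w) * 1 + Fy (a + u) (b + u * w) * w)).
    { apply (HF (fun u => a + u) (fun u => b + u * w)); auto_derive; easy || ring. }
    assert (D2 : is_derive (fun u => F (a + u) (b + u * w)) u ((INR (S m) * 1 * u ^ m) * P u w + u ^ S m * Pu u w)).
    { apply (is_derive_ext (fun u => u ^ S m * P u w)); [intros; now rewrite E|].
      apply (is_derive_mult (fun u => u ^ S m) (fun u => P u w)); [|apply Du | intros; apply Rmult_comm].
      apply (is_derive_pow (fun u => u) (S m)), is_derive_R_id. }
    apply is_derive_unique in D1, D2. lra. }
  assert (E2 : forall u w, Fy (a + u) (b + u * w) = u ^ m * Pw u w).
  { apply (polyfun_cancel (fun u w => Fy (a + u) (b + u * w)) (fun u w => u ^ m * Pw u w) 0); [polyfun_tac | polyfun_tac |].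
    intros u w; specialize (Ew u w); simpl in Ew; lra. }
  exists (fun u w => INR (S m) * P u w + u * Pu u w - w * Pw u w), Pw.
  split; [polyfun_tac|]; split; [exact Hw|]; split; [|exact E2].
  intros u w. specialize (Eu u w). rewrite E2 in Eu.
  replace (u ^ S m) with (u * u ^ m) in Eu by reflexivity. lra.
Qed.

Lemma pull_derive a b s m F Fx Fy P : polyfun P -> polyfun Fx -> polyfun Fy -> chain_partials F Fx Fy ->
  (forall u w, pull a b s F u w = u ^ S m * P u w) ->
  exists P1 P2, polyfun P1 /\ polyfun P2 /\
    (forall u w, pull a b s Fx u w = u ^ m * P1 u w) /\
    (forall u w, pull a b s Fy u w = u ^ m * P2 u w).
Proof.
  intros HP Hx Hy HF E; destruct s; unfold pull, cx, cy in *.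
  - exact (pull_derive_true a b m F Fx Fy P HP Hx Hy HF E).
  - destruct (pull_derive_true b a m (fun x y => F y x) (fun x y => Fy y x) (fun x y => Fx y x) P HP)
      as (P1 & P2 & H1 & H2 & E1 & E2).
    + now apply polyfun_swap.
    + now apply polyfun_swap.
    + intros A B t A' B' HA HB. rewrite Rplus_comm. now apply HF.
    + exact E.
    + exists P2, P1; now repeat split.
Qed.

(** * Order along the exceptional divisor and differentiability *)

(* [h] vanishes to order [L] along the exceptional divisor, near the point [(0, w)] of chart [s]. *)
Definition vanishes (L : nat) (h : fn2) (a b : R) (s : bool) (w : R) : Prop :=
  exists P Q, polyfun P /\ polyfun Q /\ Q 0 w <> 0 /\
    forall u w', Q u w' * pull a b s h u w' = u ^ L * P u w'.

(* The germ version of [vanishes], with the quotient written in the coordinates of the plane. *)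
Definition vanishes_germ (L : nat) (h : fn2) (a b : R) (s : bool) (w : R) : Prop :=
  exists n q p Q P, polyfun q /\ polyfun p /\ polyfun Q /\ polyfun P /\ Q 0 w <> 0 /\
    locally_2d (fun x y => q x y * h x y = p x y) a b /\
    (forall u w', pull a b s q u w' = u ^ S n * Q u w') /\
    (forall u w', pull a b s p u w' = u ^ (S n + L) * P u w').

(* The factor [u] makes the identity [q h = p] hold on the line [u = 0] too, which the chart misses. *)
Lemma pushed_quotient (h P Q : fn2) L a b s : polyfun P -> polyfun Q ->
  (forall u w', Q u w' * pull a b s h u w' = u ^ L * P u w') ->
  exists n q p, polyfun q /\ polyfun p /\ (forall x y, q x y * h x y = p x y) /\
    (forall u w', pull a b s q u w' = u ^ S n * Q u w') /\
    (forall u w', pull a b s p u w' = u ^ (S n + L) * P u w').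
Proof.
  intros HP HQ E.
  destruct (polyfun_push a b s P HP) as (n1 & H1). destruct (polyfun_push a b s Q HQ) as (n2 & H2).
  set (n := Nat.max n1 n2).
  destruct (H1 (n + L)%nat) as (p & Hp & Ep); [lia|]. destruct (H2 n) as (q & Hq & Eq); [lia|].
  assert (HU := polyfun_ucoord a b s).
  exists n, (fun x y => ucoord a b s x y * q x y), (fun x y => ucoord a b s x y * p x y).
  split; [polyfun_tac|]; split; [polyfun_tac|]; split; [|split].
  - intros x y. destruct (Req_dec (ucoord a b s x y) 0) as [Z|Z]; [rewrite Z; ring|].
    destruct (pull_surj a b s x y Z) as (w & Ex & Ey).
    set (u := ucoord a b s x y) in *. rewrite Ex, Ey.
    change (u * pull a b s q u w * pull a b s h u w = u * pull a b s p u w).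
    rewrite Ep, Eq, pow_add. replace (u * (u ^ n * Q u w) * pull a b s h u w) with (u * u ^ n * (Q u w * pull a b s h u w)) by ring.
    rewrite E; ring.
  - intros u w'; unfold pull at 1; rewrite pull_ucoord. fold (pull a b s q u w'). rewrite Eq; simpl; ring.
  - intros u w'; unfold pull at 1; rewrite pull_ucoord. fold (pull a b s p u w'). rewrite Ep; simpl; ring.
Qed.

Lemma vanishes_to_germ L h a b s w : vanishes L h a b s w -> vanishes_germ L h a b s w.
Proof.
  intros (P & Q & HP & HQ & Hw & E).
  destruct (pushed_quotient h P Q L a b s HP HQ E) as (n & q & p & Hq & Hp & Eh & Eq & Ep).
  exists n, q, p, Q, P; repeat (split; [assumption|]). split; [apply locally_2d_forall, Eh | now split].
Qed.

Lemma vanishes_germ_S L h a b s w : vanishes_germ (S L) h a b s w -> vanishes_germ L h a b s w.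
Proof.
  intros (n & q & p & Q & P & Hq & Hp & HQ & HP & Hw & E & Eq & Ep).
  exists n, q, p, Q, (fun u w => u * P u w); split; [exact Hq|]; split; [exact Hp|]; split; [exact HQ|].
  split; [polyfun_tac|]. split; [exact Hw|]; split; [exact E|]; split; [exact Eq|].
  intros u w'; rewrite Ep. replace (S n + S L)%nat with (S (S n + L)) by lia. simpl; ring.
Qed.

Lemma vanishes_germ_le L L' h a b s w : (L' <= L)%nat -> vanishes_germ L h a b s w -> vanishes_germ L' h a b s w.
Proof. induction 1; [easy|]. intros H1; now apply IHle, vanishes_germ_S. Qed.

Lemma locally_2d_pull (P : R -> R -> Prop) a b s w : locally_2d P a b ->
  locally_2d (fun u w' => P (a + cx s u w') (b + cy s u w')) 0 w.
Proof.
  intros [del H].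
  assert (C : forall F, polyfun F -> F 0 w = 0 -> locally_2d (fun u v => Rabs (F u v) < del) 0 w).
  { intros F HF Z. generalize (polyfun_continuity F 0 w HF del). apply locally_2d_mono.
    intros u v; now rewrite Z, Rminus_0_r. }
  assert (C1 := C (cx s) ltac:(unfold cx; polyfun_tac) ltac:(unfold cx; destruct s; ring)).
  assert (C2 := C (cy s) ltac:(unfold cy; polyfun_tac) ltac:(unfold cy; destruct s; ring)).
  generalize (locally_2d_and _ _ _ _ C1 C2); apply locally_2d_mono; intros u v [K1 K2].
  apply H; [replace (a + cx s u v - a) with (cx s u v) by ring | replace (b + cy s u v - b) with (cy s u v) by ring]; assumption.
Qed.

(** Compactness of the part of the divisor with slope in [[-1, 1]]; the two charts together cover
    the whole divisor by such segments. *)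
Lemma uniform_on_segment (P : R -> R -> Prop) :
  (forall w, locally_2d P 0 w) ->
  exists del : posreal, forall u w, Rabs u < del -> -1 <= w <= 1 -> P u w.
Proof.
  intros H.
  set (delta := fun w => proj1_sig (constructive_indefinite_description _ (H w))).
  assert (Hd : forall w u v, Rabs (u - 0) < delta w -> Rabs (v - w) < delta w -> P u v).
  { intros w; exact (proj2_sig (constructive_indefinite_description _ (H w))). }
  destruct (compactness_value_1d (-1) 1 delta) as [d HC].
  exists d; intros u w Hu Hw. apply NNPP; intros N; apply (HC w Hw). intros (t & _ & Ht & Hdt).
  apply N, (Hd t); [rewrite Rminus_0_r; lra | exact Ht].
Qed.

(** A point near [(a, b)] has slope in [[-1, 1]] in the chart belonging to its larger offset, and
    there [h] is uniformly small by compactness. *)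
Lemma vanishes_germ_continuity h a b : h a b = 0 -> (forall s w, vanishes_germ 1 h a b s w) ->
  continuity_2d_pt h a b.
Proof.
  intros H0 HV eps.
  assert (U : forall s, exists del : posreal, forall u w, Rabs u < del -> -1 <= w <= 1 ->
    Rabs (pull a b s h u w) < eps).
  { intros s; apply (uniform_on_segment (fun u w => Rabs (pull a b s h u w) < eps)). intros w.
    destruct (HV s w) as (n & q & p & Q & P & _ & _ & HQ & HP & Hw & E & Eq & Ep).
    assert (C : continuity_2d_pt (fun u w => u * P u w * / Q u w) 0 w).
    { apply continuity_2d_pt_mult.
      - apply continuity_2d_pt_mult; [apply continuity_2d_pt_id1 | now apply polyfun_continuity].
      - apply continuity_2d_pt_inv; [now apply polyfun_continuity | exact Hw]. }
    generalize (locally_2d_and _ _ _ _ (locally_2d_pull _ a b s w E)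
      (locally_2d_and _ _ _ _ (C eps) (continuity_2d_pt_neq_0 _ _ _ (polyfun_continuity Q 0 w HQ) Hw))).
    apply locally_2d_mono. intros u v (K1 & K2 & K3).
    destruct (Req_dec u 0) as [->|Hu]; [rewrite pull_0, H0, Rabs_R0; apply cond_pos|].
    replace (u * P u v * / Q u v - 0 * P 0 w * / Q 0 w) with (u * P u v * / Q u v) in K2 by ring.
    replace (pull a b s h u v) with (u * P u v * / Q u v); [exact K2|].
    change (pull a b s q u v * pull a b s h u v = pull a b s p u v) in K1.
    rewrite Eq, Ep, pow_add in K1.
    apply (Rmult_eq_reg_l (u ^ S n * Q u v)); [rewrite K1; field; exact K3|].
    apply Rmult_integral_contrapositive; split; [now apply pow_nonzero | exact K3]. }
  destruct (U true) as [d1 H1], (U false) as [d2 H2].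
  assert (Hm : 0 < Rmin d1 d2) by (apply Rmin_glb_lt; apply cond_pos).
  exists (mkposreal _ Hm); simpl; intros x y Hx Hy. rewrite H0, Rminus_0_r.
  assert (M1 := Rmin_l d1 d2). assert (M2 := Rmin_r d1 d2).
  assert (Q : forall p r : R, Rabs p <= Rabs r -> r <> 0 -> -1 <= p / r <= 1).
  { intros p r Hpr Hr. apply Rabs_le_between. unfold Rdiv; rewrite Rabs_mult, Rabs_inv.
    assert (0 < Rabs r) by now apply Rabs_pos_lt.
    apply (Rmult_le_reg_r (Rabs r)); [assumption|]. rewrite Rmult_assoc, Rinv_l; lra. }
  destruct (Rle_dec (Rabs (y - b)) (Rabs (x - a))) as [L|L].
  - destruct (Req_dec (x - a) 0) as [Z|Z].
    + rewrite Z, Rabs_R0 in L. assert (y - b = 0).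
      { apply NNPP; intros K; apply Rabs_pos_lt in K; lra. }
      replace x with a by lra; replace y with b by lra. rewrite H0, Rabs_R0; apply cond_pos.
    + specialize (H1 (x - a) ((y - b) / (x - a)) ltac:(lra) (Q _ _ L Z)).
      unfold pull, cx, cy in H1.
      replace (a + (x - a)) with x in H1 by ring.
      replace (b + (x - a) * ((y - b) / (x - a))) with y in H1 by (field; exact Z). exact H1.
  - assert (Z : y - b <> 0). { intros Z; rewrite Z, Rabs_R0 in L. generalize (Rabs_pos (x - a)); lra. }
    specialize (H2 (y - b) ((x - a) / (y - b)) ltac:(lra) (Q (x - a) (y - b) ltac:(lra) Z)).
    unfold pull, cx, cy in H2.
    replace (b + (y - b)) with y in H2 by ring.
    replace (a + (y - b) * ((x - a) / (y - b))) with x in H2 by (field; exact Z). exact H2.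
Qed.

(** The Leibniz rule for [q h = p], multiplied by [q] to replace [q h] by [p]. Nothing is divided,
    so it also holds at zeros of [q]. *)
Lemma quotient_derive (h q p qx qy px py : fn2) x y :
  locally_2d (fun u v => q u v * h u v = p u v) x y ->
  locally_2d (fun u v => ex_derive (fun t => h t v) u /\ ex_derive (fun t => h u t) v) x y ->
  chain_partials q qx qy -> chain_partials p px py ->
  locally_2d (fun u v => (q u v * q u v) * pdx h u v = q u v * px u v - qx u v * p u v /\
                         (q u v * q u v) * pdy h u v = q u v * py u v - qy u v * p u v) x y.
Proof.
  intros E HD Cq Cp. generalize (locally_2d_and _ _ _ _ (locally_2d_near _ _ _ E) HD).
  apply locally_2d_mono; intros u v [E1 [Hx Hy]].
  assert (E0 := locally_2d_singleton _ _ _ E1).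
  assert (P1 : forall F Fx Fy, chain_partials F Fx Fy -> is_derive (fun t => F t v) u (Fx u v)).
  { intros F Fx Fy C. replace (Fx u v) with (Fx u v * 1 + Fy u v * 0) by ring.
    apply (C (fun t => t) (fun _ => v)); [apply is_derive_R_id | apply is_derive_R_const]. }
  assert (P2 : forall F Fx Fy, chain_partials F Fx Fy -> is_derive (fun t => F u t) v (Fy u v)).
  { intros F Fx Fy C. replace (Fy u v) with (Fx u v * 0 + Fy u v * 1) by ring.
    apply (C (fun _ => u) (fun t => t)); [apply is_derive_R_const | apply is_derive_R_id]. }
  split.
  - assert (D1 : is_derive (fun t => q t v * h t v) u (qx u v * h u v + q u v * pdx h u v)).
    { apply (is_derive_mult (fun t => q t v) (fun t => h t v)); [exact (P1 _ _ _ Cq) | apply Derive_correct, Hx | intros; apply Rmult_comm]. }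
    assert (D2 : is_derive (fun t => q t v * h t v) u (px u v)).
    { apply (is_derive_ext_loc (fun t => p t v)); [|exact (P1 _ _ _ Cp)].
      generalize (locally_2d_1d_const_y _ _ _ E1); apply filter_imp; intros t Ht; now symmetry. }
    apply is_derive_unique in D1, D2. rewrite D1 in D2. rewrite <- D2, <- E0; ring.
  - assert (D1 : is_derive (fun t => q u t * h u t) v (qy u v * h u v + q u v * pdy h u v)).
    { apply (is_derive_mult (fun t => q u t) (fun t => h u t)); [exact (P2 _ _ _ Cq) | apply Derive_correct, Hy | intros; apply Rmult_comm]. }
    assert (D2 : is_derive (fun t => q u t * h u t) v (py u v)).
    { apply (is_derive_ext_loc (fun t => p u t)); [|exact (P2 _ _ _ Cp)].
      generalize (locally_2d_1d_const_x _ _ _ E1); apply filter_imp; intros t Ht; now symmetry. }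
    apply is_derive_unique in D1, D2. rewrite D1 in D2. rewrite <- D2, <- E0; ring.
Qed.

Lemma regular_germ_derive h x y : regular_germ h x y -> regular_germ (pdx h) x y /\ regular_germ (pdy h) x y.
Proof.
  intros Hr. destruct (regular_germ_CkAt 1 h x y Hr) as (_ & HD & _).
  destruct Hr as (p & q & Hp & Hq & Hn & E).
  destruct (polyfun_derive p Hp) as (px & py & Hpx & Hpy & Cp).
  destruct (polyfun_derive q Hq) as (qx & qy & Hqx & Hqy & Cq).
  assert (K := quotient_derive h q p qx qy px py x y E HD Cq Cp).
  split.
  - exists (fun u v => q u v * px u v - qx u v * p u v), (fun u v => q u v * q u v).
    split; [polyfun_tac|]; split; [polyfun_tac|]; split; [nra|].
    revert K; apply locally_2d_mono; tauto.
  - exists (fun u v => q u v * py u v - qy u v * p u v), (fun u v => q u v * q u v).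
    split; [polyfun_tac|]; split; [polyfun_tac|]; split; [nra|].
    revert K; apply locally_2d_mono; tauto.
Qed.

(** In the quotient rule [q^2] has order [2n + 2] in [u], and both terms of the numerator are
    divisible by [u^(2n + 2 + L)], since each differentiation costs one power. *)
Lemma vanishes_germ_derive L h a b s w :
  locally_2d (fun u v => ex_derive (fun t => h t v) u /\ ex_derive (fun t => h u t) v) a b ->
  vanishes_germ (S L) h a b s w ->
  vanishes_germ L (pdx h) a b s w /\ vanishes_germ L (pdy h) a b s w.
Proof.
  intros HD (n & q & p & Q & P & Hq & Hp & HQ & HP & Hw & E & Eq & Ep).
  destruct (polyfun_derive p Hp) as (px & py & Hpx & Hpy & Cp).
  destruct (polyfun_derive q Hq) as (qx & qy & Hqx & Hqy & Cq).
  assert (K := quotient_derive h q p qx qy px py a b E HD Cq Cp).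
  destruct (pull_derive a b s n q qx qy Q HQ Hqx Hqy Cq Eq) as (Q1 & Q2 & HQ1 & HQ2 & E1 & E2).
  destruct (pull_derive a b s (S n + L) p px py P HP Hpx Hpy Cp) as (P1 & P2 & HP1 & HP2 & E3 & E4).
  { intros u v; rewrite Ep; do 2 f_equal; lia. }
  split.
  - exists (n + S n)%nat, (fun x y => q x y * q x y), (fun x y => q x y * px x y - qx x y * p x y),
      (fun u v => Q u v * Q u v), (fun u v => Q u v * P1 u v - Q1 u v * P u v).
    do 4 (split; [polyfun_tac|]). split; [nra|]. split; [revert K; apply locally_2d_mono; tauto|].
    split; intros u v.
    + change (pull a b s q u v * pull a b s q u v = u ^ S (n + S n) * (Q u v * Q u v)).
      rewrite Eq. replace (S (n + S n)) with (S n + S n)%nat by lia. rewrite pow_add; ring.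
    + change (pull a b s q u v * pull a b s px u v - pull a b s qx u v * pull a b s p u v
        = u ^ (S (n + S n) + L) * (Q u v * P1 u v - Q1 u v * P u v)).
      rewrite Eq, E3, E1, Ep. replace (S (n + S n) + L)%nat with (S n + (S n + L))%nat by lia.
      replace (S n + S L)%nat with (1 + (S n + L))%nat by lia. rewrite !(pow_add u (S n) (S n + L)).
      rewrite (pow_add u 1 (S n + L)), pow_1. generalize (u ^ (S n + L)); intros X. change (u ^ S n) with (u * u ^ n). ring.
  - exists (n + S n)%nat, (fun x y => q x y * q x y), (fun x y => q x y * py x y - qy x y * p x y),
      (fun u v => Q u v * Q u v), (fun u v => Q u v * P2 u v - Q2 u v * P u v).
    do 4 (split; [polyfun_tac|]). split; [nra|]. split; [revert K; apply locally_2d_mono; tauto|].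
    split; intros u v.
    + change (pull a b s q u v * pull a b s q u v = u ^ S (n + S n) * (Q u v * Q u v)).
      rewrite Eq. replace (S (n + S n)) with (S n + S n)%nat by lia. rewrite pow_add; ring.
    + change (pull a b s q u v * pull a b s py u v - pull a b s qy u v * pull a b s p u v
        = u ^ (S (n + S n) + L) * (Q u v * P2 u v - Q2 u v * P u v)).
      rewrite Eq, E4, E2, Ep. replace (S (n + S n) + L)%nat with (S n + (S n + L))%nat by lia.
      replace (S n + S L)%nat with (1 + (S n + L))%nat by lia. rewrite !(pow_add u (S n) (S n + L)).
      rewrite (pow_add u 1 (S n + L)), pow_1. generalize (u ^ (S n + L)); intros X. change (u ^ S n) with (u * u ^ n). ring.
Qed.

(** The axis [w = 0] maps to a coordinate line through [(a, b)], where [h] equals [u^2 P / Q]. This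
    gives the partial derivative at the blown-up point itself, where no regular germ is
    available. *)
Lemma vanishes_germ_axis h a b s : h a b = 0 -> vanishes_germ 2 h a b s 0 ->
  is_derive (fun t => pull a b s h t 0) 0 0.
Proof.
  intros H0 (n & q & p & Q & P & _ & _ & HQ & HP & Hw & E & Eq & Ep).
  assert (HQ0 : polyfun (fun u _ => Q u 0)) by polyfun_tac.
  assert (HP0 : polyfun (fun u _ => P u 0)) by polyfun_tac.
  destruct (polyfun_partials _ HQ0) as (Qu & _ & _ & _ & DQ & _).
  destruct (polyfun_partials _ HP0) as (Pu & _ & _ & _ & DP & _).
  specialize (DQ 0 0); specialize (DP 0 0); simpl in DQ, DP.
  apply (is_derive_ext_loc (fun t => t * t * P t 0 / Q t 0)).
  - assert (N := continuity_2d_pt_neq_0 _ _ _ (polyfun_continuity Q 0 0 HQ) Hw).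
    generalize (locally_2d_1d_const_y _ _ _ (locally_2d_and _ _ _ _ (locally_2d_pull _ a b s 0 E) N)).
    apply filter_imp; intros t [Et Nt].
    change (pull a b s q t 0 * pull a b s h t 0 = pull a b s p t 0) in Et.
    rewrite Eq, Ep, pow_add in Et. change (t * t * P t 0 / Q t 0 = pull a b s h t 0 :> R).
    destruct (Req_dec t 0) as [->|Ht]; [rewrite pull_0, H0; field; exact Hw|].
    apply (Rmult_eq_reg_l (t ^ S n * Q t 0)); [rewrite Et; field; exact Nt|].
    apply Rmult_integral_contrapositive; split; [now apply pow_nonzero | exact Nt].
  - auto_derive.
    + split; [now exists (Pu 0 0) | split; [now exists (Qu 0 0) | split; [exact Hw | easy]]].
    + field; exact Hw.
Qed.

(** Induction on [k]: order at least 2 makes both partial derivatives exist and vanish at [(a, b)],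
    and they satisfy the same hypotheses with the order lowered by one. *)
Lemma vanishes_germ_CkAt k : forall h a b, h a b = 0 ->
  locally_2d (fun x y => (x, y) <> (a, b) -> regular_germ h x y) a b ->
  (forall s w, vanishes_germ (S k) h a b s w) -> CkAt k h a b.
Proof.
  induction k as [|k IH]; intros h a b H0 Hr HV;
    assert (Hc : locally_2d (continuity_2d_pt h) a b).
  1, 3: revert Hr; apply locally_2d_mono; intros x y Hxy;
    destruct (classic ((x, y) = (a, b))) as [Z|Z];
    [ injection Z as -> ->; apply vanishes_germ_continuity; [exact H0|];
      intros s w; eapply vanishes_germ_le; [|apply HV]; lia
    | exact (locally_2d_singleton _ _ _ (regular_germ_CkAt 0 h x y (Hxy Z))) ].
  - exact Hc.
  - assert (Dax : is_derive (fun t => h t b) a 0).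
    { assert (K := vanishes_germ_axis h a b true H0 (vanishes_germ_le (S (S k)) 2 _ _ _ _ _ ltac:(lia) (HV true 0))).
      apply (is_derive_ext (fun t => pull a b true h (t - a) 0)).
      { intros t; unfold pull, cx, cy; f_equal; ring. }
      assert (S1 : is_derive (fun t => t - a) a 1) by (auto_derive; [easy | ring]).
      assert (K' : is_derive (fun t => pull a b true h t 0) (a - a) 0) by (rewrite Rminus_diag; exact K).
      assert (C := is_derive_comp (fun t => pull a b true h t 0) (fun t => t - a) a _ _ K' S1).
      change (scal 1 0) with (1 * 0) in C; rewrite Rmult_0_r in C; exact C. }
    assert (Day : is_derive (fun t => h a t) b 0).
    { assert (K := vanishes_germ_axis h a b false H0 (vanishes_germ_le (S (S k)) 2 _ _ _ _ _ ltac:(lia) (HV false 0))).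
      apply (is_derive_ext (fun t => pull a b false h (t - b) 0)).
      { intros t; unfold pull, cx, cy; f_equal; ring. }
      assert (S1 : is_derive (fun t => t - b) b 1) by (auto_derive; [easy | ring]).
      assert (K' : is_derive (fun t => pull a b false h t 0) (b - b) 0) by (rewrite Rminus_diag; exact K).
      assert (C := is_derive_comp (fun t => pull a b false h t 0) (fun t => t - b) b _ _ K' S1).
      change (scal 1 0) with (1 * 0) in C; rewrite Rmult_0_r in C; exact C. }
    assert (HD : locally_2d (fun u v => ex_derive (fun t => h t v) u /\ ex_derive (fun t => h u t) v) a b).
    { revert Hr; apply locally_2d_mono; intros x y Hxy.
      destruct (classic ((x, y) = (a, b))) as [Z|Z].
      - injection Z as -> ->; split; [now exists 0 | now exists 0].
      - destruct (regular_germ_CkAt 1 h x y (Hxy Z)) as (_ & K & _). exact (locally_2d_singleton _ _ _ K). }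
    split; [exact Hc|]; split; [exact HD|]; split; apply IH.
    + now apply is_derive_unique.
    + revert Hr; apply locally_2d_mono; intros x y Hxy Z; now apply regular_germ_derive, Hxy.
    + intros s w; now apply (vanishes_germ_derive (S k) h a b s w HD).
    + now apply is_derive_unique.
    + revert Hr; apply locally_2d_mono; intros x y Hxy Z; now apply regular_germ_derive, Hxy.
    + intros s w; now apply (vanishes_germ_derive (S k) h a b s w HD).
Qed.

(** * Regular functions and ideals *)

(** Multiplying by [r] extends the identity to the zeros of [r], so that denominators become
    polynomial identities on the whole plane; conversely [q] can serve as its own [r]. *)
Lemma regular_at_iff f x y : regular_at f x y <->
  exists P Q, polyfun P /\ polyfun Q /\ Q x y <> 0 /\ forall u v, Q u v * f u v = P u v.
Proof.
  split.
  - intros (p & q & r & Hq & Hr & H).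
    exists (fun u v => peval p u v * peval r u v), (fun u v => peval q u v * peval r u v).
    assert (Pf : forall p, polyfun (peval p)) by (intros p0; now exists p0).
    split; [apply polyfun_mult; apply Pf|]; split; [apply polyfun_mult; apply Pf|].
    split; [now apply Rmult_integral_contrapositive|].
    intros u v; destruct (Req_dec (peval r u v) 0) as [Z|Z]; [rewrite Z; ring|].
    destruct (H u v Z) as [H1 ->]; field; exact H1.
  - intros (P & Q & [p Hp] & [q Hq] & Hn & E). exists p, q, q. rewrite <- Hq.
    split; [exact Hn|]; split; [exact Hn|]. intros u v Hu; split; [exact Hu|].
    rewrite <- Hp, <- Hq, <- E. rewrite <- Hq in Hu. field; exact Hu.
Qed.

Lemma rational2_iff f : rational2 f <->
  exists P Q, polyfun P /\ polyfun Q /\ (exists x y, Q x y <> 0) /\ forall u v, Q u v * f u v = P u v.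
Proof.
  split.
  - intros (p & q & r & (x & y & Hr) & H).
    assert (K : regular_at f x y) by (exists p, q, r; split; [now apply H | now split]).
    apply regular_at_iff in K. destruct K as (P & Q & HP & HQ & Hn & E).
    exists P, Q; repeat (split; [assumption|]). split; [now exists x, y | exact E].
  - intros (P & Q & HP & HQ & (x & y & Hn) & E).
    assert (K : regular_at f x y) by (apply regular_at_iff; now exists P, Q).
    destruct K as (p & q & r & Hq & Hr & H). exists p, q, r; split; [now exists x, y | exact H].
Qed.

Lemma vanishes_0_iff f a b s w : vanishes 0 f a b s w <-> regular_at (pull a b s f) 0 w.
Proof.
  rewrite regular_at_iff; split; intros (P & Q & HP & HQ & Hn & E); exists P, Q;
    repeat (split; [assumption|]); intros u v; rewrite E; simpl; ring.
Qed.

Lemma regular_at_vanishes f a b s w : regular_at f a b -> vanishes 0 f a b s w.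
Proof.
  rewrite regular_at_iff; intros (P & Q & HP & HQ & Hn & E).
  exists (pull a b s P), (pull a b s Q). split; [now apply polyfun_pull|]; split; [now apply polyfun_pull|].
  split; [now rewrite pull_0|]. intros u v; unfold pull; rewrite E; simpl; ring.
Qed.

Lemma regular_after_blowup_iff S f : regular_after_blowup S f <->
  (forall x y, ~ In (x, y) S -> regular_at f x y) /\
  (forall a b s w, In (a, b) S -> vanishes 0 f a b s w).
Proof.
  split; intros [H1 H2]; (split; [exact H1|]).
  - intros a b s w Hab; apply vanishes_0_iff. destruct (H2 (a, b) Hab w) as [K1 K2].
    destruct s; [exact K1 | exact K2].
  - intros [a b] Hab w; split.
    + exact (proj1 (vanishes_0_iff f a b true w) (H2 a b true w Hab)).
    + exact (proj1 (vanishes_0_iff f a b false w) (H2 a b false w Hab)).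
Qed.

Lemma regular_after_blowup_vanishes S f a b s w : regular_after_blowup S f -> vanishes 0 f a b s w.
Proof.
  intros H; apply regular_after_blowup_iff in H; destruct H as [H1 H2].
  destruct (classic (In (a, b) S)) as [K|K]; [now apply H2 | now apply regular_at_vanishes, H1].
Qed.

Lemma polyfun_Rk1 k F : polyfun F -> Rk1 k F.
Proof.
  intros HF. assert (HR : forall x y, regular_at F x y).
  { intros x y; apply regular_at_iff; exists F, (fun _ _ => 1); split; [exact HF|].
    split; [apply polyfun_const|]; split; [lra | intros; ring]. }
  split; [split|].
  - apply CkAt_Ck; intros x y; now apply polyfun_CkAt.
  - apply rational2_iff; exists F, (fun _ _ => 1); split; [exact HF|].
    split; [apply polyfun_const|]; split; [exists 0, 0; lra | intros; ring].
  - exists []; apply regular_after_blowup_iff; split; [intros; apply HR | easy].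
Qed.

(** The pulled back [g] is zero on [u = 0], so its numerator is divisible by [u]. *)
Lemma vanishes_zero g a b s w : g a b = 0 -> vanishes 0 g a b s w -> vanishes 1 g a b s w.
Proof.
  intros H0 (P & Q & HP & HQ & Hw & E). destruct (polyfun_taylor P 0 HP) as (P1 & H1 & E1).
  exists P1, Q; repeat (split; [assumption|]). intros u v; rewrite E, E1.
  replace (P 0 v) with 0; [simpl; ring|]. specialize (E 0 v); rewrite pull_0, H0 in E; simpl in E; lra.
Qed.

Lemma vanishes_pow g a b s w N : vanishes 1 g a b s w -> vanishes N (fun x y => g x y ^ N) a b s w.
Proof.
  intros (P & Q & HP & HQ & Hw & E).
  exists (fun u v => P u v ^ N), (fun u v => Q u v ^ N).
  split; [polyfun_tac|]; split; [polyfun_tac|]; split; [now apply pow_nonzero|].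
  intros u v. change (Q u v ^ N * pull a b s g u v ^ N = u ^ N * P u v ^ N).
  rewrite <- !Rpow_mult_distr, E; f_equal; simpl; ring.
Qed.

(** The strict transform of [F] avoids the point [(0, w)] of the exceptional divisor; of the order
    itself only a bound is kept. *)
Definition order_le (M : nat) (F : fn2) (a b : R) (s : bool) (w : R) : Prop :=
  exists n Q, (n <= M)%nat /\ polyfun Q /\ Q 0 w <> 0 /\ forall u v, pull a b s F u v = u ^ n * Q u v.

Lemma order_le_mult M M' F G a b s w : order_le M F a b s w -> order_le M' G a b s w ->
  order_le (M + M') (fun x y => F x y * G x y) a b s w.
Proof.
  intros (n & Q & Hn & HQ & Hw & E) (n' & Q' & Hn' & HQ' & Hw' & E').
  exists (n + n')%nat, (fun u v => Q u v * Q' u v); split; [lia|]; split; [polyfun_tac|].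
  split; [now apply Rmult_integral_contrapositive|].
  intros u v. change (pull a b s F u v * pull a b s G u v = u ^ (n + n') * (Q u v * Q' u v)).
  rewrite E, E', pow_add; ring.
Qed.

Lemma order_le_nonzero F a b s w : polyfun F -> F a b <> 0 -> order_le 0 F a b s w.
Proof.
  intros HF Hn; exists O, (pull a b s F); split; [lia|]; split; [now apply polyfun_pull|].
  split; [now rewrite pull_0|]. intros; simpl; ring.
Qed.

(** The spare 1 in the bound leaves a positive power of [u] in the numerator, so that the identity
    also holds at [u = 0], where [u^n] cannot be cancelled. *)
Lemma vanishes_quotient (h r D : fn2) M N L a b s w : h a b = 0 -> (M + L + 1 <= N)%nat ->
  order_le M D a b s w -> vanishes N r a b s w -> (forall x y, D x y * h x y = r x y) ->
  vanishes L h a b s w.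
Proof.
  intros H0 HN (n & E & Hn & HE & Hw & EE) (P & Q & HP & HQ & HQw & EP) Eh.
  exists (fun u v => u ^ (N - n - L) * P u v), (fun u v => E u v * Q u v).
  split; [polyfun_tac|]; split; [polyfun_tac|]; split; [now apply Rmult_integral_contrapositive|].
  intros u v. destruct (Req_dec u 0) as [->|Hu].
  - rewrite pull_0, H0. rewrite (pow_i (N - n - L)) by lia. ring.
  - specialize (Eh (a + cx s u v) (b + cy s u v)).
    change (pull a b s D u v * pull a b s h u v = pull a b s r u v) in Eh.
    rewrite EE in Eh. apply (Rmult_eq_reg_l (u ^ n)); [|now apply pow_nonzero].
    transitivity (Q u v * (u ^ n * E u v * pull a b s h u v)); [ring|].
    rewrite Eh, EP. replace N with (n + (L + (N - n - L)))%nat at 1 by lia. rewrite !pow_add; ring.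
Qed.

(** Two factors [g] absorb [d^2], also where [d] vanishes. At [f = 0] both sides are zero, because
    [g = 0] and [N - 2] is positive. *)
Lemma quotient_identity (f g d q p q1 B : R) N : (3 <= N)%nat -> (f = 0 -> g = 0) ->
  q * g = d * p -> q1 * q1 * f = d * d * B ->
  (q1 * q1) * (B * (q * q)) * (g ^ N / f) = (q1 * q1 * (q1 * q1) * (p * p)) * g ^ (N - 2).
Proof.
  intros HN H0 E1 E2. replace N with (2 + (N - 2))%nat at 1 by lia. rewrite pow_add.
  destruct (Req_dec f 0) as [Z|Z].
  - rewrite (H0 Z), (pow_i (N - 2)) by lia. unfold Rdiv; ring.
  - apply (Rmult_eq_reg_r f); [|exact Z]. set (X := g ^ (N - 2)).
    transitivity (q1 * q1 * B * (q * g) * (q * g) * X); [field; exact Z|]. rewrite E1.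
    transitivity (q1 * q1 * (d * d * B) * p * p * X); [ring|]. rewrite <- E2; ring.
Qed.

(** * Divisibility by the common divisor at points and directions *)

Definition rep_point (d g : fn2) (x y : R) : Prop :=
  exists q p, polyfun q /\ polyfun p /\ q x y <> 0 /\ forall u v, q u v * g u v = d u v * p u v.

(** Divisibility by [d] after the blowing-up, where the quotient may have a pole of order at most
    [n] along the exceptional divisor. *)
Definition rep_dir (n : nat) (d g : fn2) (a b : R) (s : bool) (w : R) : Prop :=
  exists q p Q, polyfun q /\ polyfun p /\ polyfun Q /\ Q 0 w <> 0 /\
    (forall u v, pull a b s q u v = u ^ n * Q u v) /\ forall u v, q u v * g u v = d u v * p u v.

Lemma rep_dir_le n n' d g a b s w : (n <= n')%nat -> rep_dir n d g a b s w -> rep_dir n' d g a b s w.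
Proof.
  induction 1 as [|m _ IH]; [easy|]. intros H; destruct (IH H) as (q & p & Q & Hq & Hp & HQ & Hw & E & Eg).
  assert (HU := polyfun_ucoord a b s).
  exists (fun x y => ucoord a b s x y * q x y), (fun x y => ucoord a b s x y * p x y), Q.
  split; [polyfun_tac|]; split; [polyfun_tac|]; split; [exact HQ|]; split; [exact Hw|]; split.
  - intros u v; unfold pull at 1; rewrite pull_ucoord; fold (pull a b s q u v); rewrite E; simpl; ring.
  - intros u v; rewrite Rmult_assoc, Eg; ring.
Qed.

(** Quasi-compactness in the Zariski topology: one open set [Q 0 <> 0] misses finitely many [w], and
    each of these gets an order of its own. *)
Lemma uniform_order (P : nat -> R -> Prop) : (forall n n' w, (n <= n')%nat -> P n w -> P n' w) ->
  (forall w, exists n Q, polyfun Q /\ Q 0 w <> 0 /\ forall w', Q 0 w' <> 0 -> P n w') ->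
  exists n, forall w, P n w.
Proof.
  intros Hm H. destruct (H 0) as (n0 & Q0 & HQ & H0 & HP).
  destruct (polyfun_finite_roots (fun w => Q0 0 w)) as [l Hl]; [now apply polyfun_fix_fst | now exists 0 |].
  assert (K : exists n, forall w, In w l -> P n w).
  { clear Hl; induction l as [|w l [n IH]]; [exists O; easy|].
    destruct (H w) as (n1 & Q1 & _ & Hw & HP1). exists (n + n1)%nat. intros w' [<-|Hw'].
    - apply (Hm n1); [lia | now apply HP1].
    - apply (Hm n); [lia | now apply IH]. }
  destruct K as [n1 K]. exists (n0 + n1)%nat; intros w. destruct (Req_dec (Q0 0 w) 0) as [Z|Z].
  - apply (Hm n1); [lia|]. apply K, Hl, Z.
  - apply (Hm n0); [lia|]. now apply HP.
Qed.

Lemma uniform_bool_order (P : nat -> bool -> R -> Prop) :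
  (forall n n' s w, (n <= n')%nat -> P n s w -> P n' s w) ->
  (forall s, exists n, forall w, P n s w) -> exists n, forall s w, P n s w.
Proof.
  intros Hm H; destruct (H true) as [n1 H1], (H false) as [n2 H2]; exists (n1 + n2)%nat; intros [|] w.
  - apply (Hm n1); [lia | apply H1].
  - apply (Hm n2); [lia | apply H2].
Qed.

Lemma uniform_list_order {A : Type} (P : nat -> A -> Prop) (l : list A) :
  (forall n n' a, (n <= n')%nat -> P n a -> P n' a) ->
  (forall a, In a l -> exists n, P n a) -> exists n, forall a, In a l -> P n a.
Proof.
  intros Hm; induction l as [|a l IH]; intros H; [exists O; easy|].
  destruct IH as [n1 H1]; [intros; apply H; now right|]. destruct (H a) as [n2 H2]; [now left|].
  exists (n1 + n2)%nat; intros a' [<-|Ha].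
  - apply (Hm n2); [lia | exact H2].
  - apply (Hm n1); [lia | now apply H1].
Qed.

Definition polynomial_part (I : fn2 -> Prop) : fn2 -> Prop := fun p => polyfun p /\ I p.

Lemma polynomial_part_ideal k I : is_ideal_Rk1 k I -> poly_ideal (polynomial_part I).
Proof.
  intros (_ & I0 & Iplus & Imul). split; [|split; [|split]].
  - now intros p [Hp _].
  - split; [apply polyfun_const | exact I0].
  - intros p q [Hp Ip] [Hq Iq]; split; [polyfun_tac | now apply Iplus].
  - intros a p Ha [Hp Ip]; split; [polyfun_tac | apply Imul; [now apply polyfun_Rk1 | exact Ip]].
Qed.

(* A denominator [q] of [g] satisfies [q g] in the polynomial part of the ideal, so [d] divides it. *)
Lemma ideal_denominator k I d g q p : is_ideal_Rk1 k I ->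
  (forall p, polynomial_part I p -> divides_up_to_unit d p) -> I g -> polyfun q -> polyfun p ->
  (forall x y, q x y * g x y = p x y) ->
  exists c p', polyfun c /\ polyfun p' /\ (forall x y, c x y <> 0) /\
    forall x y, (c x y * q x y) * g x y = d x y * p' x y.
Proof.
  intros (_ & _ & _ & Imul) Hdiv Ig Hq Hp E. destruct (Hdiv p) as (c & p' & Hc & Hp' & Nc & Ec).
  - split; [exact Hp|]. apply (fn2_ext I (fun x y => q x y * g x y) p E).
    apply Imul; [now apply polyfun_Rk1 | exact Ig].
  - exists c, p'; repeat (split; [assumption|]). intros x y; rewrite Rmult_assoc, E; apply Ec.
Qed.

Lemma ideal_rep_point k I d g x y : is_ideal_Rk1 k I ->
  (forall p, polynomial_part I p -> divides_up_to_unit d p) -> I g -> regular_at g x y -> rep_point d g x y.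
Proof.
  intros HI Hdiv Ig Hr. apply regular_at_iff in Hr; destruct Hr as (P & Q & HP & HQ & Hn & E).
  destruct (ideal_denominator k I d g Q P HI Hdiv Ig HQ HP E) as (c & p' & Hc & Hp' & Nc & Ec).
  exists (fun x y => c x y * Q x y), p'; split; [polyfun_tac|]; split; [exact Hp'|]; split; [|exact Ec].
  apply Rmult_integral_contrapositive; split; [apply Nc | exact Hn].
Qed.

(** The order must not depend on the direction, because it determines a single exponent [K] in the
    generator and a single power [N]. *)
Lemma ideal_rep_dir k I d g a b : is_ideal_Rk1 k I ->
  (forall p, polynomial_part I p -> divides_up_to_unit d p) -> I g ->
  exists n, forall s w, rep_dir n d g a b s w.
Proof.
  intros HI Hdiv Ig. apply uniform_bool_order; [intros; eapply rep_dir_le; eassumption|]. intros s.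
  apply uniform_order; [intros; eapply rep_dir_le; eassumption|]. intros w.
  destruct (proj1 HI g Ig) as (_ & Sg & HS).
  destruct (regular_after_blowup_vanishes Sg g a b s w HS) as (P & Q & HP & HQ & Hw & E).
  destruct (pushed_quotient g P Q 0 a b s HP HQ E) as (n & q & p & Hq & Hp & Eg & Eq & _).
  destruct (ideal_denominator k I d g q p HI Hdiv Ig Hq Hp Eg) as (c & p' & Hc & Hp' & Nc & Ec).
  exists (S n), Q; split; [exact HQ|]; split; [exact Hw|]. intros w' Hw'.
  assert (Hpc := polyfun_pull a b s c Hc).
  exists (fun x y => c x y * q x y), p', (fun u v => pull a b s c u v * Q u v).
  split; [polyfun_tac|]; split; [exact Hp'|]; split; [polyfun_tac|]; split; [|split; [|exact Ec]].
  - apply Rmult_integral_contrapositive; split; [apply Nc | exact Hw'].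
  - intros u v. change (pull a b s c u v * pull a b s q u v = u ^ S n * (pull a b s c u v * Q u v)).
    rewrite Eq; ring.
Qed.

(** * The generator and the quotients *)

Lemma rootprod_divides_pow X l : (forall r, In r l -> In r X) ->
  exists A, polyfun (fun x _ => A x) /\ forall x, rootprod X x ^ length l = A x * rootprod l x.
Proof.
  induction l as [|r l IH]; intros H.
  - exists (fun _ => 1); split; [apply polyfun_const | intros; simpl; ring].
  - destruct IH as (A & HA & E); [intros; apply H; now right|].
    destruct (in_split r X) as (X1 & X2 & EX); [apply H; now left|].
    assert (H1 := polyfun_rootprod (X1 ++ X2)).
    exists (fun x => A x * rootprod (X1 ++ X2) x); split; [polyfun_tac|].
    intros x; simpl; rewrite E. rewrite EX at 1. rewrite !rootprod_app; simpl; ring.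
Qed.

Lemma rootprod_simple_root X r : NoDup X -> In r X ->
  exists A, polyfun (fun x _ => A x) /\ A r <> 0 /\ forall x, rootprod X x = (x - r) * A x.
Proof.
  intros HX Hr; destruct (in_split r X Hr) as (X1 & X2 & ->).
  exists (rootprod (X1 ++ X2)); split; [apply polyfun_rootprod|]; split.
  - rewrite rootprod_0. now apply NoDup_remove_2.
  - intros x; rewrite !rootprod_app; simpl; ring.
Qed.

(** At a grid point [(a, b')] the two squares are [(x - a)^(2M)] and [(y - b')^(2M)] times units,
    and [x - a], [y - b'] are never both of higher order in one direction. So the sum has order
    exactly [2M] everywhere on the divisor. *)
Lemma grid_function l (b : R -> R) : polyfun (fun y _ => b y) -> (exists y, b y <> 0) ->
  exists (e A B : fn2) Z m, polyfun e /\ polyfun A /\ polyfun B /\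
    (forall x y, e x y = A x y * rootprod l x + B x y * b y) /\
    (forall x y, e x y = 0 -> In (x, y) Z) /\
    (forall x y s w, In (x, y) Z -> order_le m e x y s w).
Proof.
  intros Hb Zb. destruct (polyfun_factor b Hb Zb) as (l2 & b0 & Hb0 & Nb0 & Eb).
  set (X := nodup Req_dec_T l). set (Y := nodup Req_dec_T l2).
  (* One exponent for both coordinates, large enough for [rootprod X ^ M] to be a multiple of
     [rootprod l] and [rootprod Y ^ M] of [rootprod l2]. *)
  set (M := (length l + length l2)%nat).
  destruct (rootprod_divides_pow X l) as (A & HA & EA); [intros; now apply nodup_In|].
  destruct (rootprod_divides_pow Y l2) as (B & HB & EB); [intros; now apply nodup_In|].
  assert (HX := polyfun_rootprod X). assert (HY := polyfun_rootprod Y).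
  exists (fun x y => (rootprod X x ^ M) ^ 2 + (b0 y * rootprod Y y ^ M) ^ 2),
    (fun x y => rootprod X x ^ M * (rootprod X x ^ length l2 * A x)),
    (fun x y => b0 y * rootprod Y y ^ M * (rootprod Y y ^ length l * B y)),
    (list_prod X Y), (M + M)%nat.
  split; [polyfun_tac|]; split; [polyfun_tac|]; split; [polyfun_tac|]; split; [|split].
  - intros x y. rewrite Eb.
    replace (rootprod X x ^ M) with (rootprod X x ^ length l2 * (A x * rootprod l x)).
    2: { rewrite <- EA, <- pow_add; f_equal; unfold M; lia. }
    replace (rootprod Y y ^ M) with (rootprod Y y ^ length l * (B y * rootprod l2 y)).
    2: { rewrite <- EB, <- pow_add; f_equal; unfold M; lia. }
    ring.
  - intros x y E. assert (K1 : rootprod X x ^ M = 0) by nra. assert (K2 : b0 y * rootprod Y y ^ M = 0) by nra.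
    apply in_prod; apply rootprod_0; apply NNPP; intros N.
    + now apply (pow_nonzero _ M N).
    + destruct (Rmult_integral _ _ K2) as [K|K]; [now apply (Nb0 y) | now apply (pow_nonzero _ M N)].
  - intros a b' s w Hab. apply in_prod_iff in Hab; destruct Hab as [Ha Hb'].
    destruct (rootprod_simple_root X a (NoDup_nodup _ _) Ha) as (A1 & HA1 & NA1 & EA1).
    destruct (rootprod_simple_root Y b' (NoDup_nodup _ _) Hb') as (B1 & HB1 & NB1 & EB1).
    assert (NA := pow_nonzero _ M NA1). assert (NB := pow_nonzero _ M NB1). assert (N0 := Nb0 b').
    destruct s.
    (* In this chart the first square, divided by [u^(2M)], is positive at [u = 0]; in the other
       chart the second one is. *)
    + exists (M + M)%nat, (fun u v => (A1 (a + u) ^ M) ^ 2 + (b0 (b' + u * v) * (v * B1 (b' + u * v)) ^ M) ^ 2).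
      split; [lia|]; split; [polyfun_tac|]; split.
      * rewrite Rplus_0_r. assert (0 < (A1 a ^ M) ^ 2) by nra. generalize (pow2_ge_0 (b0 (b' + 0 * w) * (w * B1 (b' + 0 * w)) ^ M)); lra.
      * intros u v; unfold pull, cx, cy. rewrite EA1, EB1.
        replace (a + u - a) with u by ring. replace (b' + u * v - b') with (u * v) by ring.
        rewrite !Rpow_mult_distr, pow_add; ring.
    + exists (M + M)%nat, (fun u v => ((v * A1 (a + u * v)) ^ M) ^ 2 + (b0 (b' + u) * B1 (b' + u) ^ M) ^ 2).
      split; [lia|]; split; [polyfun_tac|]; split.
      * rewrite Rplus_0_r. assert (b0 b' * B1 b' ^ M <> 0) by now apply Rmult_integral_contrapositive.
        assert (0 < (b0 b' * B1 b' ^ M) ^ 2) by nra. generalize (pow2_ge_0 ((w * A1 (a + 0 * w)) ^ M)); lra.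
      * intros u v; unfold pull, cx, cy. rewrite EA1, EB1.
        replace (b' + u - b') with u by ring. replace (a + u * v - a) with (u * v) by ring.
        rewrite !Rpow_mult_distr, pow_add; ring.
Qed.

Definition points_poly (C : list (R * R)) : fn2 := fun x y =>
  fold_right (fun c acc => ((x - fst c) ^ 2 + (y - snd c) ^ 2) * acc) 1 C.

Lemma polyfun_points_poly C : polyfun (points_poly C).
Proof.
  induction C as [|c C IH]; [apply (polyfun_const 1)|].
  apply (polyfun_mult (fun x y => (x - fst c) ^ 2 + (y - snd c) ^ 2) (points_poly C)); [polyfun_tac | exact IH].
Qed.

Lemma points_poly_ge_0 C x y : 0 <= points_poly C x y.
Proof.
  induction C as [|c C IH]; simpl; [lra|]. apply Rmult_le_pos; [|exact IH].
  generalize (pow2_ge_0 (x - fst c)), (pow2_ge_0 (y - snd c)); simpl; lra.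
Qed.

Lemma points_poly_neq_0 C x y : ~ In (x, y) C -> points_poly C x y <> 0.
Proof.
  induction C as [|[a b] C IH]; simpl; intros H; [lra|].
  apply Rmult_integral_contrapositive; split; [|apply IH; tauto].
  intros E; apply H; left. replace (_ + _) with (Rsqr (x - a) + Rsqr (y - b)) in E by (unfold Rsqr; ring).
  destruct (Rplus_sqr_eq_0 _ _ E); f_equal; lra.
Qed.

Lemma points_poly_pull C a b s : In (a, b) C ->
  exists T, polyfun T /\ forall u v, pull a b s (points_poly C) u v = u * T u v.
Proof.
  intros Hab. destruct (polyfun_taylor _ 0 (polyfun_pull a b s _ (polyfun_points_poly C))) as (T & HT & E).
  exists T; split; [exact HT|]. intros u v; rewrite E, pull_0.
  replace (points_poly C a b) with 0; [ring|]. symmetry; clear E HT T.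
  induction C as [|c C IH]; [easy|]. destruct Hab as [->|Hab]; simpl; [ring|].
  fold (points_poly C a b). rewrite IH by exact Hab; ring.
Qed.

(* [f] is [d^2] times a function of bounded exact order, in the sense that [q1^2 f = d^2 B]. *)
Definition rep_square (M : nat) (d f : fn2) (a b : R) (s : bool) (w : R) : Prop :=
  exists q1 B, polyfun q1 /\ polyfun B /\ (forall x y, q1 x y * q1 x y * f x y = d x y * d x y * B x y) /\
    order_le M q1 a b s w /\ order_le M B a b s w.

Lemma order_le_mono M M' F a b s w : (M <= M')%nat -> order_le M F a b s w -> order_le M' F a b s w.
Proof. intros H (n & Q & Hn & K); exists n, Q; split; [lia | exact K]. Qed.

Lemma rep_square_mono M M' d f a b s w : (M <= M')%nat -> rep_square M d f a b s w -> rep_square M' d f a b s w.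
Proof.
  intros H (q1 & B & Hq & HB & E & O1 & O2); exists q1, B; repeat (split; [assumption|]).
  split; eapply order_le_mono; eassumption.
Qed.

(** From [q G = d p] one gets [q^2 f = d^2 ((q e)^2 + t p^2)], and the bracket is positive where
    [q e] is nonzero because [t >= 0]. *)
Lemma rep_square_point (d e t G : fn2) a b s w : polyfun d -> polyfun e -> polyfun t ->
  (forall x y, 0 <= t x y) -> e a b <> 0 -> rep_point d G a b ->
  exists q1 B, polyfun q1 /\ polyfun B /\ q1 a b <> 0 /\ B a b <> 0 /\
    (forall x y, q1 x y * q1 x y * ((d x y * e x y) * (d x y * e x y) + t x y * (G x y * G x y))
       = d x y * d x y * B x y) /\
    order_le 0 q1 a b s w /\ order_le 0 B a b s w.
Proof.
  intros Hd He Ht Ht0 Hn (q & p & Hq & Hp & Nq & E).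
  exists q, (fun x y => (q x y * e x y) * (q x y * e x y) + t x y * (p x y * p x y)).
  assert (HB : polyfun (fun x y => (q x y * e x y) * (q x y * e x y) + t x y * (p x y * p x y))) by polyfun_tac.
  assert (NB : (q a b * e a b) * (q a b * e a b) + t a b * (p a b * p a b) <> 0).
  { assert (q a b * e a b <> 0) by now apply Rmult_integral_contrapositive.
    assert (0 < (q a b * e a b) * (q a b * e a b)) by nra.
    assert (0 <= t a b * (p a b * p a b)) by (apply Rmult_le_pos; [apply Ht0 | nra]). lra. }
  repeat (split; [assumption|]). split; [|split; now apply order_le_nonzero].
  intros x y. transitivity (d x y * d x y * ((q x y * e x y) * (q x y * e x y)) + t x y * (q x y * G x y) * (q x y * G x y)); [ring|].
  rewrite E; ring.
Qed.

(** In the bracket [(q e)^2 + T^K p^2] the first term has exact order at most [2n + 2m] and the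
    second has order at least [K], so the first decides. *)
Lemma rep_square_dir (d e T G : fn2) n m K a b s w : polyfun e -> polyfun T ->
  (exists T1, polyfun T1 /\ forall u v, pull a b s T u v = u * T1 u v) ->
  order_le m e a b s w -> rep_dir n d G a b s w -> (2 * n + 2 * m + 1 <= K)%nat ->
  rep_square (2 * n + 2 * m) d
    (fun x y => (d x y * e x y) * (d x y * e x y) + T x y ^ K * (G x y * G x y)) a b s w.
Proof.
  intros He HT (T1 & HT1 & ET) (m' & E & Hm & HE & Ew & Ee) (q & p & Q & Hq & Hp & HQ & Hw & Eq & EG) HK.
  exists q, (fun x y => (q x y * e x y) * (q x y * e x y) + T x y ^ K * (p x y * p x y)).
  split; [exact Hq|]; split; [polyfun_tac|]; split; [|split].
  - intros x y. transitivity (d x y * d x y * ((q x y * e x y) * (q x y * e x y)) + T x y ^ K * (q x y * G x y) * (q x y * G x y)); [ring|].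
    rewrite EG; ring.
  - exists n, Q; split; [lia|]; now split.
  - assert (Hpp := polyfun_pull a b s p Hp).
    exists (2 * (n + m'))%nat, (fun u v => (Q u v * E u v) * (Q u v * E u v)
      + u ^ (K - 2 * (n + m')) * (T1 u v ^ K * (pull a b s p u v * pull a b s p u v))).
    split; [lia|]; split; [polyfun_tac|]; split.
    + rewrite (pow_i (K - 2 * (n + m'))) by lia. rewrite Rmult_0_l, Rplus_0_r.
      assert (Q 0 w * E 0 w <> 0) by now apply Rmult_integral_contrapositive. nra.
    + intros u v.
      change ((pull a b s q u v * pull a b s e u v) * (pull a b s q u v * pull a b s e u v)
        + pull a b s T u v ^ K * (pull a b s p u v * pull a b s p u v) = u ^ (2 * (n + m')) * ((Q u v * E u v) * (Q u v * E u v)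
      + u ^ (K - 2 * (n + m')) * (T1 u v ^ K * (pull a b s p u v * pull a b s p u v)))).
      rewrite Eq, Ee, ET, Rpow_mult_distr.
      replace (u ^ K) with (u ^ (2 * (n + m')) * u ^ (K - 2 * (n + m'))) by (rewrite <- pow_add; f_equal; lia).
      replace (2 * (n + m'))%nat with (n + m' + (n + m'))%nat by lia. rewrite !pow_add; ring.
Qed.

(** The denominator [q1^2 B q^2] has order at most [3M + 2n], the numerator at least [N - 2]; one
    more power is spent in [vanishes_quotient]. *)
Lemma quotient_vanishes (d f g : fn2) M n N L a b s w : (3 * M + 2 * n + L + 3 <= N)%nat ->
  (forall x y, f x y = 0 -> g x y = 0) -> g a b = 0 -> vanishes 0 g a b s w ->
  rep_square M d f a b s w -> rep_dir n d g a b s w ->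
  vanishes L (fun x y => g x y ^ N / f x y) a b s w.
Proof.
  intros HN H0 Hg Vg (q1 & B & Hq1 & HB & Ef & O1 & O2) (q & p & Q & Hq & Hp & HQ & Hw & Eq & Eg).
  assert (Oq : order_le n q a b s w) by (exists n, Q; split; [lia|]; now split).
  destruct (vanishes_pow g a b s w (N - 2) (vanishes_zero g a b s w Hg Vg)) as (P' & Q' & HP' & HQ' & Hw' & E').
  set (Rr := fun x y => q1 x y * q1 x y * (q1 x y * q1 x y) * (p x y * p x y)).
  assert (HR : polyfun Rr) by (unfold Rr; polyfun_tac).
  apply (vanishes_quotient _ (fun x y => Rr x y * g x y ^ (N - 2))
    (fun x y => (q1 x y * q1 x y) * (B x y * (q x y * q x y))) ((M + M) + (M + (n + n))) (N - 2)).
  - rewrite Hg, pow_i by lia. unfold Rdiv; ring.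
  - lia.
  - repeat apply order_le_mult; assumption.
  - assert (HRp := polyfun_pull a b s Rr HR).
    exists (fun u v => pull a b s Rr u v * P' u v), Q'; split; [polyfun_tac|]; split; [exact HQ'|]; split; [exact Hw'|].
    intros u v. transitivity (pull a b s Rr u v * (Q' u v * pull a b s (fun x y => g x y ^ (N - 2)) u v)); [unfold pull; ring|].
    rewrite E'; ring.
  - intros x y; unfold Rr. apply (quotient_identity (f x y) (g x y) (d x y)); [lia | apply H0 | apply Eg | apply Ef].
Qed.

Lemma quotient_regular_at (d f g q1 B : fn2) N a b : (3 <= N)%nat ->
  (forall x y, f x y = 0 -> g x y = 0) -> polyfun d -> polyfun q1 -> polyfun B -> q1 a b <> 0 -> B a b <> 0 ->
  (forall x y, q1 x y * q1 x y * f x y = d x y * d x y * B x y) -> rep_point d g a b ->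
  regular_at (fun x y => g x y ^ N / f x y) a b.
Proof.
  intros HN H0 Hd Hq1 HB N1 NB Ef (q & p & Hq & Hp & Nq & Eg). apply regular_at_iff.
  (* The extra factor [q^(N-2)] turns the remaining [g^(N-2)] into the polynomial [(d p)^(N-2)]. *)
  exists (fun x y => (q1 x y * q1 x y * (q1 x y * q1 x y) * (p x y * p x y)) * (d x y * p x y) ^ (N - 2)),
    (fun x y => q x y ^ (N - 2) * ((q1 x y * q1 x y) * (B x y * (q x y * q x y)))).
  split; [polyfun_tac|]; split; [polyfun_tac|]; split.
  - repeat (apply Rmult_integral_contrapositive; split); try assumption. now apply pow_nonzero.
  - intros x y. rewrite Rmult_assoc.
    rewrite (quotient_identity (f x y) (g x y) (d x y) (q x y) (p x y)) by (auto; apply Eg || apply Ef).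
    rewrite <- Eg, Rpow_mult_distr; ring.
Qed.

Lemma quotient_vanishes_0 (f g : fn2) N a b s w : (1 <= N)%nat -> (forall x y, f x y = 0 -> g x y = 0) ->
  f a b <> 0 -> vanishes 0 f a b s w -> vanishes 0 g a b s w ->
  vanishes 0 (fun x y => g x y ^ N / f x y) a b s w.
Proof.
  intros HN H0 Hf (Pf & Qf & HPf & HQf & Hwf & Ef) (Pg & Qg & HPg & HQg & Hwg & Eg).
  exists (fun u v => Pg u v ^ N * Qf u v), (fun u v => Qg u v ^ N * Pf u v).
  split; [polyfun_tac|]; split; [polyfun_tac|]; split.
  - apply Rmult_integral_contrapositive; split; [now apply pow_nonzero|].
    specialize (Ef 0 w); rewrite pull_0 in Ef; simpl in Ef. rewrite Rmult_1_l in Ef. rewrite <- Ef.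
    now apply Rmult_integral_contrapositive.
  - intros u v. specialize (Ef u v); specialize (Eg u v). simpl in Ef, Eg; rewrite Rmult_1_l in Ef, Eg.
    change (Qg u v ^ N * Pf u v * (pull a b s g u v ^ N / pull a b s f u v) = u ^ 0 * (Pg u v ^ N * Qf u v)).
    rewrite <- Ef, <- Eg, Rpow_mult_distr. destruct (Req_dec (pull a b s f u v) 0) as [Z|Z].
    + rewrite Z. assert (Zg : pull a b s g u v = 0) by (apply H0, Z). rewrite Zg, pow_i by lia. unfold Rdiv; simpl; ring.
    + simpl; field; exact Z.
Qed.

Lemma classical_filter {A : Type} (P : A -> Prop) (l : list A) :
  exists l', forall x, In x l' <-> In x l /\ P x.
Proof.
  induction l as [|a l [l' IH]]; [exists []; simpl; tauto|].
  destruct (classic (P a)) as [Ha|Ha].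
  - exists (a :: l'); intros x; simpl; rewrite IH. split; [|tauto].
    intros [<-|[? ?]]; tauto.
  - exists l'; intros x; simpl; rewrite IH. split; [tauto|]. intros [[<-|?] ?]; tauto.
Qed.

Lemma list_avoids_point (l : list (R * R)) : exists x y, ~ In (x, y) l.
Proof.
  destruct (interval_avoids_list (map fst l) 0 1) as (x & _ & Hx); [lra|].
  exists x, 0; intros H; apply Hx. change x with (fst (x, 0)). now apply in_map.
Qed.

Lemma locally_avoids_list (l : list (R * R)) a b :
  locally_2d (fun x y => (x, y) <> (a, b) -> ~ In (x, y) l) a b.
Proof.
  induction l as [|[c d] l IH]; [apply locally_2d_forall; intros; easy|].
  destruct (classic ((c, d) = (a, b))) as [E|E].
  - revert IH; apply locally_2d_mono; intros x y H N [K|K]; [congruence | now apply H].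
  - assert (Nz : (a - c) ^ 2 + (b - d) ^ 2 <> 0).
    { intros Z. replace (_ + _) with (Rsqr (a - c) + Rsqr (b - d)) in Z by (unfold Rsqr; ring).
      destruct (Rplus_sqr_eq_0 _ _ Z). apply E; f_equal; lra. }
    assert (HF : polyfun (fun x y => (x - c) ^ 2 + (y - d) ^ 2)) by polyfun_tac.
    generalize (locally_2d_and _ _ _ _ IH (continuity_2d_pt_neq_0 _ a b (polyfun_continuity _ a b HF) Nz)).
    apply locally_2d_mono; intros x y [H H'] N [K|K]; [|now apply H].
    injection K as -> ->; apply H'; ring.
Qed.

(** Squares are added point by point, so values already positive stay positive. *)
Lemma ideal_nonzero_on_list k I (W : list (R * R)) : is_ideal_Rk1 k I ->
  (forall x y, In (x, y) W -> exists g, I g /\ g x y <> 0) ->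
  exists G, I G /\ (forall x y, 0 <= G x y) /\ forall x y, In (x, y) W -> G x y <> 0.
Proof.
  intros (IR & I0 & Iplus & Imul); induction W as [|[a b] W IH]; intros HW.
  - exists (fun _ _ => 0); split; [exact I0|]; split; [intros; lra | easy].
  - destruct IH as (G & IG & HG & NG); [intros; apply HW; now right|].
    destruct (HW a b) as (g & Ig & Ng); [now left|].
    exists (fun x y => G x y + g x y * g x y); split; [|split].
    + apply (Iplus G (fun x y => g x y * g x y) IG). apply Imul; [now apply IR | exact Ig].
    + intros x y; generalize (HG x y); nra.
    + intros x y [E|Hxy]; generalize (HG x y).
      * injection E as <- <-; assert (0 < g a b * g a b) by nra; lra.
      * specialize (NG x y Hxy); nra.
Qed.

(** If the polynomial part were zero, every denominator [Q] of [g] would vanish on the open set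
    where [g] does not, hence everywhere. *)
Lemma polynomial_part_nonzero k I g x y : is_ideal_Rk1 k I -> I g -> g x y <> 0 ->
  exists p u v, polynomial_part I p /\ p u v <> 0.
Proof.
  intros (IR & _ & _ & Imul) Ig Hg. destruct (IR g Ig) as [[HC Hr] _].
  apply rational2_iff in Hr; destruct Hr as (P & Q & HP & HQ & (x0 & y0 & NQ) & E).
  assert (Hc := locally_2d_singleton _ _ _ (CkAt_cont _ _ _ _ (Ck_CkAt k g HC x y))).
  destruct (continuity_2d_pt_neq_0 _ _ _ Hc Hg) as [del Hdel].
  apply NNPP; intros N. apply NQ. apply (polyfun_zero_box Q x y del HQ (cond_pos del)).
  intros u v Hu Hv. specialize (Hdel u v Hu Hv).
  assert (Z : P u v = 0).
  { apply NNPP; intros Z; apply N; exists P, u, v; split; [split; [exact HP|] | exact Z].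
    apply (fn2_ext I (fun x y => Q x y * g x y) P E).
    apply Imul; [now apply polyfun_Rk1 | exact Ig]. }
  rewrite <- E in Z. destruct (Rmult_integral _ _ Z); [assumption | contradiction].
Qed.

(* Away from the finitely many points where [g] is not regular, [g] vanishes with [d]. *)
Lemma exceptional_points_finite k I d : is_ideal_Rk1 k I -> polyfun d -> (exists x y, d x y <> 0) ->
  (forall p, polynomial_part I p -> divides_up_to_unit d p) ->
  exists L, forall x y g, d x y = 0 -> I g -> g x y <> 0 -> In (x, y) L.
Proof.
  intros HI Hd Zd Hdiv. destruct (isolated_zeros_finite d Hd Zd) as [L HL].
  exists L; intros x y g Hxy Ig Ng. apply HL; [exact Hxy|].
  destruct (proj1 HI g Ig) as [[HC _] [Sg HS]]. exists Sg.
  assert (Hc := locally_2d_singleton _ _ _ (CkAt_cont _ _ _ _ (Ck_CkAt k g HC x y))).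
  generalize (continuity_2d_pt_neq_0 _ _ _ Hc Ng). apply locally_2d_mono; intros u v Nuv Zuv.
  apply NNPP; intros Hout.
  destruct (ideal_rep_point k I d g u v HI Hdiv Ig (proj1 HS u v Hout)) as (q & p & _ & _ & Nq & E).
  specialize (E u v); rewrite Zuv, Rmult_0_l in E. destruct (Rmult_integral _ _ E); contradiction.
Qed.

Lemma ideal_radical_generator k I : is_ideal_Rk1 k I -> exists f, I f /\
  forall g, I g -> exists N h, Rk1 k h /\ forall x y, g x y ^ N = f x y * h x y.
Proof.
  intros HI. destruct (classic (exists g x y, I g /\ g x y <> 0)) as [(g0 & x0 & y0 & Ig0 & Ng0)|Hzero].
  2: { exists (fun _ _ => 0); split; [apply HI|]. intros g Ig; exists 1%nat, (fun _ _ => 0).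
       split; [apply polyfun_Rk1, polyfun_const|]. intros x y.
       replace (g x y) with 0; [ring|]. symmetry; apply NNPP; intros Z; apply Hzero; now exists g, x, y. }
  assert (HJ := polynomial_part_ideal k I HI).
  destruct (polynomial_part_nonzero k I g0 x0 y0 HI Ig0 Ng0) as (p0 & u0 & v0 & Hp0 & Np0).
  destruct (poly_ideal_divisor _ HJ) as (d & l & bb & Hd & Zd & Hdiv & Jl & Hbb & Zbb & Jb); [now exists p0, u0, v0|].
  destruct (grid_function l bb Hbb Zbb) as (e & A & B & Z & m & He & HA & HB & Ee & Ze & Oe).
  destruct (exceptional_points_finite k I d HI Hd Zd Hdiv) as [L HL].
  (* [L] accounts for the zeros of [d] and [Z] for those of [e]. *)
  destruct (classical_filter (fun z => exists g, I g /\ g (fst z) (snd z) <> 0) (L ++ Z)) as [W HW].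
  destruct (ideal_nonzero_on_list k I W HI) as (G & IG & _ & NG).
  { intros x y Hxy; apply HW in Hxy; exact (proj2 Hxy). }
  assert (RG := proj1 HI G IG). destruct RG as [_ [SG HSG]].
  (* Points of [W] are left out even if [G] is not regular there: [T] must not vanish on [W], where
     [T^K G^2] keeps [f] positive. *)
  destruct (classical_filter (fun z => ~ In z W) (Z ++ SG)) as [C HC].
  (* This bound involves [G] but no other element of the ideal, so [K] and [f] are fixed before [g]
     is given. *)
  destruct (uniform_list_order (fun n z => forall s w, rep_dir n d G (fst z) (snd z) s w) C) as [nG HnG].
  { intros n n' z Hn H s w; exact (rep_dir_le n n' _ _ _ _ _ _ Hn (H s w)). }
  { intros [a b] _; exact (ideal_rep_dir k I d G a b HI Hdiv IG). }
  set (T := points_poly C). assert (HT : polyfun T) by apply polyfun_points_poly.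
  set (K := (2 * nG + 2 * m + 1)%nat).
  set (f := fun x y => (d x y * e x y) * (d x y * e x y) + T x y ^ K * (G x y * G x y)).
  assert (HTK : forall x y, 0 <= T x y ^ K) by (intros; apply pow_le, points_poly_ge_0).
  assert (If : I f).
  { destruct HI as (IR & I0 & Iplus & Imul). destruct HJ as (_ & _ & Jplus & Jmul).
    assert (Jde : polynomial_part I (fun x y => d x y * e x y)).
    { apply (fn2_ext _ (fun x y => A x y * (rootprod l x * d x y) + B x y * (bb y * d x y))).
      { intros x y; rewrite Ee; ring. }
      apply (Jplus (fun x y => A x y * (rootprod l x * d x y)) (fun x y => B x y * (bb y * d x y))); now apply Jmul. }
    apply (Iplus (fun x y => (d x y * e x y) * (d x y * e x y)) (fun x y => T x y ^ K * (G x y * G x y))).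
    - apply (Jmul (fun x y => d x y * e x y) (fun x y => d x y * e x y)); [polyfun_tac | exact Jde].
    - apply (Imul (fun x y => T x y ^ K)); [apply polyfun_Rk1; polyfun_tac|].
      apply Imul; [now apply IR | exact IG]. }
  exists f; split; [exact If|]. intros g Ig.
  assert (fW : forall x y, f x y = 0 -> ~ In (x, y) W).
  { intros x y Hf Hxy.
    assert (NT : T x y ^ K <> 0).
    { apply pow_nonzero, points_poly_neq_0. intros HxyC; now apply HC in HxyC. }
    specialize (NG x y Hxy). assert (0 < G x y * G x y) by nra.
    assert (0 < T x y ^ K) by (specialize (HTK x y); lra).
    assert (0 < T x y ^ K * (G x y * G x y)) by now apply Rmult_lt_0_compat.
    unfold f in Hf; nra. }
  assert (fg : forall x y, f x y = 0 -> forall g', I g' -> g' x y = 0).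
  { intros x y Hf g' Ig'. apply NNPP; intros Ng'. apply (fW x y Hf), HW.
    split; [apply in_or_app | now exists g'].
    assert (Hde : d x y * e x y = 0).
    { unfold f in Hf. assert (0 <= T x y ^ K * (G x y * G x y)) by (apply Rmult_le_pos; [apply HTK | nra]). nra. }
    destruct (Rmult_integral _ _ Hde) as [Z0|Z0]; [left; exact (HL x y g' Z0 Ig' Ng') | right; now apply Ze]. }
  assert (f0 : forall x y, f x y = 0 -> g x y = 0) by (intros x y Hf; exact (fg x y Hf g Ig)).
  destruct (proj1 HI f If) as [[Cf _] [Sf HSf]].
  destruct (proj1 HI g Ig) as [[Cg _] [Sg HSg]].
  (* Outside [Bad], [e] is nonzero and both [G] and [g] are regular, so [h] is regular there even at
     zeros of [f]. *)
  set (Bad := Z ++ SG ++ Sg).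
  destruct (uniform_list_order (fun n z => f (fst z) (snd z) = 0 -> forall s w,
     rep_dir n d g (fst z) (snd z) s w /\ rep_square n d f (fst z) (snd z) s w) Bad) as [M HM].
  { intros n n' z Hn H H1 s w; destruct (H H1 s w) as [K1 K2]; split;
      [exact (rep_dir_le n n' _ _ _ _ _ _ Hn K1) | exact (rep_square_mono n n' _ _ _ _ _ _ Hn K2)]. }
  { intros [a b] Hab; simpl. destruct (ideal_rep_dir k I d g a b HI Hdiv Ig) as [n Hn].
    exists (n + (2 * nG + 2 * m))%nat; intros Hf s w.
    split; [apply (rep_dir_le n); [lia | apply Hn]|].
    assert (NW := fW a b Hf).
    (* Outside [W], a point that is not in [C] is neither in [Z] nor in [SG]; only [g] can fail to
       be regular there. *)
    destruct (classic (In (a, b) C)) as [HabC|HabC].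
    - apply (rep_square_mono (2 * nG + 2 * m)); [lia|].
      apply rep_square_dir; [exact He | exact HT | now apply points_poly_pull | | apply (HnG (a, b) HabC) | unfold K; lia].
      destruct (classic (In (a, b) Z)) as [HZ|HZ]; [now apply Oe|].
      apply (order_le_mono 0); [lia|]. apply order_le_nonzero; [exact He|]. intros E0; now apply HZ, Ze.
    - assert (NZ : ~ In (a, b) Z) by (intros HZ; apply HabC, HC; split; [apply in_or_app; now left | exact NW]).
      assert (NS : ~ In (a, b) SG) by (intros HS; apply HabC, HC; split; [apply in_or_app; now right | exact NW]).
      apply (rep_square_mono 0); [lia|].
      destruct (rep_square_point d e (fun x y => T x y ^ K) G a b s w Hd He) as (q1 & B1 & Hq1 & HB1 & _ & _ & E & O1 & O2).
      + polyfun_tac.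
      + exact HTK.
      + intros E0; now apply NZ, Ze.
      + apply (ideal_rep_point k I d G a b HI Hdiv IG), (proj1 HSG), NS.
      + exists q1, B1; now repeat (split; [assumption|]). }
  (* The bound of [quotient_vanishes] with both orders equal to [M] and [L = k + 1]. *)
  set (N := (3 * M + 2 * M + S k + 3)%nat).
  (* At zeros of [f] the numerator is zero, so [h] is zero there whatever the value of [/ 0]. *)
  set (h := fun x y => g x y ^ N / f x y).
  assert (Hreg : forall x y, ~ In (x, y) Bad -> regular_at h x y).
  { intros a b Hab.
    destruct (rep_square_point d e (fun x y => T x y ^ K) G a b true 0 Hd He) as (q1 & B1 & Hq1 & HB1 & N1 & NB & E & _).
    - polyfun_tac.
    - exact HTK.
    - intros E0; apply Hab, in_or_app; left; now apply Ze.
    - apply (ideal_rep_point k I d G a b HI Hdiv IG), (proj1 HSG).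
      intros H; apply Hab, in_or_app; right; apply in_or_app; now left.
    - apply (quotient_regular_at d f g q1 B1 N a b); try assumption; [unfold N; lia|].
      apply (ideal_rep_point k I d g a b HI Hdiv Ig), (proj1 HSg).
      intros H; apply Hab, in_or_app; right; apply in_or_app; now right. }
  assert (Hvan : forall a b s w, In (a, b) Bad -> f a b = 0 -> forall L, (L <= S k)%nat -> vanishes L h a b s w).
  { intros a b s w Hab Hf L' HL'. destruct (HM (a, b) Hab Hf s w) as [K1 K2].
    apply (quotient_vanishes d f g M M N L'); [unfold N; lia | exact f0 | now apply f0 | | exact K2 | exact K1].
    exact (regular_after_blowup_vanishes Sg g a b s w HSg). }
  exists N, h; split; [split; [split|]|].
  (* At a zero of [f] in [Bad] the order [k + 1] is used; at the other zeros [h] is regular;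
     elsewhere it is a quotient of functions of class C^k. *)
  - apply CkAt_Ck; intros x y.
    destruct (Req_dec (f x y) 0) as [Hf|Hf].
    + destruct (classic (In (x, y) Bad)) as [Hb|Hb].
      * apply vanishes_germ_CkAt.
        -- unfold h; rewrite (f0 x y Hf), pow_i by (unfold N; lia). unfold Rdiv; ring.
        -- generalize (locally_avoids_list Bad x y); apply locally_2d_mono; intros u v H1 H2.
           destruct (proj1 (regular_at_iff _ _ _) (Hreg u v (H1 H2))) as (P & Q & HP & HQ & Nq & E).
           exists P, Q; repeat (split; [assumption|]). apply locally_2d_forall, E.
        -- intros s w; apply vanishes_to_germ, Hvan; [exact Hb | exact Hf | lia].
      * destruct (proj1 (regular_at_iff _ _ _) (Hreg x y Hb)) as (P & Q & HP & HQ & Nq & E).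
        apply regular_germ_CkAt. exists P, Q; repeat (split; [assumption|]). apply locally_2d_forall, E.
    + apply (CkAt_mult k (fun x y => g x y ^ N) (fun x y => / f x y)).
      * apply CkAt_pow, Ck_CkAt, Cg.
      * apply CkAt_inv; [apply Ck_CkAt, Cf | exact Hf].
  - destruct (list_avoids_point Bad) as (x & y & Hxy). apply rational2_iff.
    destruct (proj1 (regular_at_iff _ _ _) (Hreg x y Hxy)) as (P & Q & HP & HQ & Nq & E).
    exists P, Q; repeat (split; [assumption|]). split; [now exists x, y | exact E].
  - exists Bad; apply regular_after_blowup_iff; split; [exact Hreg|]. intros a b s w Hab.
    destruct (Req_dec (f a b) 0) as [Hf|Hf]; [apply Hvan; [exact Hab | exact Hf | lia]|].
    apply quotient_vanishes_0; [unfold N; lia | exact f0 | exact Hf | |].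
    + exact (regular_after_blowup_vanishes Sf f a b s w HSf).
    + exact (regular_after_blowup_vanishes Sg g a b s w HSg).
  - intros x y; unfold h. destruct (Req_dec (f x y) 0) as [Hf|Hf]; [|field; exact Hf].
    rewrite (f0 x y Hf), Hf, pow_i by (unfold N; lia). ring.
Qed.

Theorem theorem5p16 (k : nat) (I : fn2 -> Prop) :
  is_ideal_Rk1 k I ->
  exists f : fn2, I f /\
    (forall g, I g -> exists (N : nat) (h : fn2),
        Rk1 k h /\ forall x y, (g x y) ^ N = f x y * h x y) /\
    (* sqrt(I) = sqrt((f)) in R^k_[1](R^2) *)
    (forall g, Rk1 k g ->
       ((exists N : nat, I (fun x y => (g x y) ^ N)) <->
        (exists (N : nat) (h : fn2),
           Rk1 k h /\ forall x y, (g x y) ^ N = f x y * h x y))).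
Proof.
  intros HI. destruct (ideal_radical_generator k I HI) as (f & If & Hf).
  exists f; split; [exact If|]; split; [exact Hf|]. intros g _; split.
  - intros (N & HN). destruct (Hf _ HN) as (M & h & Hh & E). exists (N * M)%nat, h; split; [exact Hh|].
    intros x y; rewrite pow_mult; apply E.
  - intros (N & h & Hh & E). exists N. destruct HI as (_ & _ & _ & Imul).
    apply (fn2_ext I (fun x y => h x y * f x y)); [intros x y; rewrite E; ring | now apply Imul].
Qed.
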